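(* Let $(X,d)$ be a nonempty complete metric space and let $(\mathcal{F},\vec p)$, $\mathcal{F}=\{w_1,\dots,w_N\}$, $\vec p=(p_1,\dots,p_N)$, be an average Rakotch contractive probabilistic IFS on $X$. Then the Markov operator $M:\mathcal{P}_1(X)\to\mathcal{P}_1(X)$, $M(\mu)=\sum_{i=1}^N p_i\,\mu\circ w_i^{-1}$, is a Rakotch contraction with respect to the Monge–Kantorovich metric $d_{MK}$. In particular, $M$ admits a unique invariant measure $\mu_*=M(\mu_* )\in\mathcal{P}_1(X)$, and for every $\mu\in\mathcal{P}_1(X)$ the iterates $M^n(\mu)$ converge weakly to $\mu_*$.
   Context: A probabilistic IFS $(\mathcal{F},\vec p)$ consists of finitely many continuous maps $w_i:X\to X$, $i=1,\dots,N$, and weights $p_i>0$ with $\sum_i p_i=1$. It is average Rakotch contractive if there are positive numbers $c_1,\dots,c_N$ such that (i) $\sum_{i=1}^N p_ic_i\le1$, and (ii) for each $i$ there is a nonincreasing $\lambda_i:[0,\infty)\to[0,\infty)$ with $\lambda_i(t)<c_i$ for $t>0$ such that $d(w_i(x),w_i(y))\le\lambda_i(d(x,y))\,d(x,y)$ for all $x,y\in X$. A selfmap $f$ of a metric space $(Y,\rho)$ is a Rakotch contraction if there is a nonincreasing $\lambda:[0,\infty)\to[0,1]$ with $\lambda(t)<1$ for $t>0$ such that $\rho(f(x),f(y))\le\lambda(\rho(x,y))\rho(x,y)$ for all $x,y$. A Borel probability measure $\mu$ is Radon if $\mu(B)=\sup\{\mu(K):K\subseteq B\text{ compact}\}$ for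 every Borel $B$. $\mathcal{P}_1(X)$ is the set of Radon probability measures $\mu$ on $X$ with $\int_X d(x,x_0)\,d\mu(x)<\infty$ for some (equivalently every) $x_0$. $d_{MK}(\mu,\nu)=\sup\{\int f\,d\mu-\int f\,d\nu:\ f:X\to\mathbb{R},\ \operatorname{Lip}(f)\le1\}$. $\mu\circ w^{-1}$ is the push-forward. Weak convergence means convergence of integrals of all bounded continuous real functions. *)

(* Defs.v *)
From HB Require Import structures.
From mathcomp Require Import all_boot all_order all_algebra.
From mathcomp Require Import all_classical all_reals all_analysis.
From mathcomp Require Import measurable_realfun lra.

Set Implicit Arguments.
Unset Strict Implicit.
Unset Printing Implicit Defensive.

Import Order.TTheory GRing.Theory Num.Theory.
Import numFieldNormedType.Exports.

Local Open Scope classical_set_scope.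
Local Open Scope ring_scope.

(* [Complete] extends [Pointed], so these spaces are nonempty. *)
#[short(type="completeMetricType")]
HB.structure Definition CompleteMetric (R : numDomainType) :=
  {T of Metric R T & CompletePseudoMetric R T}.

Definition borel (X : ptopologicalType) : measurableType _ :=
  g_sigma_algebraType (@open X).

Record pifs (R : realType) (X : topologicalType) (N : nat) := PIFS {
  pifs_map :> 'I_N -> X -> X ;
  pifs_weight : 'I_N -> R ;
  pifs_continuous : forall i, continuous (pifs_map i) ;
  pifs_weight_gt0 : forall i, 0 < pifs_weight i ;
  pifs_weight_sum : \sum_(i < N) pifs_weight i = 1
}.

Definition average_rakotch (R : realType) (X : metricType R) (N : nat)
    (w : pifs R X N) : Prop :=
  exists c : 'I_N -> R,
    [/\ forall i, 0 < c i,
        \sum_(i < N) pifs_weight w i * c i <= 1 &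
        forall i, exists lambda : R -> R,
          [/\ forall t, 0 <= t -> 0 <= lambda t,
              forall s t, 0 <= s -> s <= t -> lambda t <= lambda s,
              forall t, 0 < t -> lambda t < c i &
              forall x y, mdist (w i x) (w i y)
                          <= lambda (mdist x y) * mdist x y]].

(* [f] restricts to a Rakotch contraction of the subset [Y], for the distance
   function [rho]. *)
Definition rakotch_contraction (R : realType) (T : Type) (Y : set T)
    (rho : T -> T -> R) (f : T -> T) : Prop :=
  (forall y, Y y -> Y (f y)) /\
  exists lambda : R -> R,
    [/\ forall t, 0 <= t -> 0 <= lambda t <= 1,
        forall s t, 0 <= s -> s <= t -> lambda t <= lambda s,
        forall t, 0 < t -> lambda t < 1 &
        forall x y, Y x -> Y y ->
          rho (f x) (f y) <= lambda (rho x y) * rho x y].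

Definition radon (R : realType) (X : ptopologicalType)
    (mu : probability (borel X) R) : Prop :=
  forall B : set (borel X), measurable B ->
    mu B = ereal_sup [set mu K | K in [set K | @compact X K /\ K `<=` B]].

Definition P1 (R : realType) (X : completeMetricType R) :
    set (probability (borel X) R) :=
  [set mu | radon mu /\
     exists x0 : X, (\int[mu]_x (mdist (x : X) x0)%:E < +oo)%E].

Definition lip1 (R : realType) (X : metricType R) : set (X -> R) :=
  [set f | forall x y, `|f x - f y| <= mdist x y].

(* [sup] is only meaningful on nonempty bounded sets; see [dMK_has_sup]. *)
Definition dMK (R : realType) (X : completeMetricType R)
    (mu nu : probability (borel X) R) : R :=
  sup [set \int[mu]_x f x - \int[nu]_x f x | f in @lip1 R X].

Definition weak_cvg (R : realType) (X : ptopologicalType)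
    (mu_ : nat -> probability (borel X) R) (mu : probability (borel X) R) :
    Prop :=
  forall f : X -> R, continuous f -> bounded_fun f ->
    \int[mu_ n]_x f x @[n --> \oo] --> \int[mu]_x f x.

Lemma open_borel_measurable (X : ptopologicalType) (U : set X) :
  open U -> measurable (U : set (borel X)).
Proof. by move=> oU; exact: sub_sigma_algebra. Qed.

Lemma continuous_borel_measurable (X Y : ptopologicalType) (f : X -> Y) :
  continuous f -> measurable_fun [set: borel X] (f : borel X -> borel Y).
Proof.
move=> /continuousP cf.
apply: (measurability (@open Y : set (set (borel Y)))) => // _ [V oV <-].
by rewrite setTI; apply: open_borel_measurable; exact: cf.
Qed.

Lemma continuous_real_measurable (X : ptopologicalType) (R : realType)
  (f : X -> R) : continuous f -> measurable_fun [set: borel X] f.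
Proof.
move=> /continuousP cf.
apply: (measurability _ (RGenOpens.measurableE R)) => _ [_ [a [b ->] <-]].
rewrite setTI; apply: open_borel_measurable; apply: cf.
exact: interval_open.
Qed.

Section markov.
Local Open Scope ereal_scope.
Context (R : realType) (X : ptopologicalType) (N : nat).
Variables (w : pifs R X N) (mu : probability (borel X) R).

Definition markov_measure (A : set (borel X)) : \bar R :=
  \sum_(i < N) (pifs_weight w i)%:E *
    pushforward mu (w i : borel X -> borel X) A.

Let mw i : measurable_fun [set: borel X] (w i : borel X -> borel X).
Proof. by apply: continuous_borel_measurable; exact: pifs_continuous. Qed.

Let pushforward_sigma_additive (f : borel X -> borel X) :
  measurable_fun [set: borel X] f -> semi_sigma_additive (pushforward mu f).
Proof.
move=> mf F mF tF mUF; rewrite /pushforward preimage_bigcup.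
apply: measure_semi_sigma_additive.
- by move=> n; rewrite -[X in measurable X]setTI; exact: mf.
- apply/trivIsetP => /= i j _ _ ij; rewrite -preimage_setI.
  by move/trivIsetP : tF => /(_ _ _ _ _ ij) ->//; rewrite preimage_set0.
- by rewrite -preimage_bigcup -[X in measurable X]setTI; exact: mf.
Qed.

Let markov0 : markov_measure set0 = 0.
Proof.
by apply: big1 => i _; rewrite /pushforward preimage_set0 measure0 mule0.
Qed.

Let markov_ge0 A : 0 <= markov_measure A.
Proof.
apply: sume_ge0 => i _; apply: mule_ge0; last exact: measure_ge0.
by rewrite lee_fin ltW// pifs_weight_gt0.
Qed.

Let markov_sigma_additive : semi_sigma_additive markov_measure.
Proof.
move=> F mF tF mUF; rewrite /markov_measure.
under eq_fun do rewrite exchange_big/=.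
apply: cvg_nnesum => i _.
  apply: nearW => n; apply: sume_ge0 => k _.
  by apply: mule_ge0; [rewrite lee_fin ltW// pifs_weight_gt0|exact: measure_ge0].
rewrite (_ : (fun n => _) = (fun n => (pifs_weight w i)%:E *
    \sum_(0 <= k < n) pushforward mu (w i : borel X -> borel X) (F k))).
  apply: cvgeZl => //; exact: pushforward_sigma_additive (mw i) F mF tF mUF.
by apply/funext => n; rewrite ge0_sume_distrr// => k _; exact: measure_ge0.
Qed.

HB.instance Definition _ := isMeasure.Build _ _ _ markov_measure
  markov0 markov_ge0 markov_sigma_additive.

Let markov_setT : markov_measure [set: borel X] = 1.
Proof.
rewrite /markov_measure /pushforward.
under eq_bigr do rewrite preimage_setT probability_setT mule1.
by rewrite sumEFin pifs_weight_sum.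
Qed.

HB.instance Definition _ :=
  Measure_isProbability.Build _ _ _ markov_measure markov_setT.

Definition markov_operator : probability (borel X) R := markov_measure.

End markov.

Section dMK_sup.
Context (R : realType) (X : completeMetricType R).

Lemma lip1_continuous (f : X -> R) : lip1 f -> continuous f.
Proof.
move=> lf x; apply/(@cvgrPdist_lt _ R^o) => e e0.
near=> y; rewrite (le_lt_trans (lf x y))//.
near: y; have := nbhsx_ballx x e e0.
by rewrite ballEmdist.
Unshelve. all: by end_near. Qed.

Lemma lip1_mdist (x0 : X) : lip1 (fun x : X => mdist x x0).
Proof.
move=> x y; rewrite ler_norml.
have := metric_triangle x y x0; have := metric_triangle y x x0.
by rewrite (metric_sym y x); lra.
Qed.

Lemma lip1_integrable (mu : probability (borel X) R) (f : X -> R) :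
  P1 mu -> lip1 f -> mu.-integrable [set: borel X] (EFin \o f).
Proof.
move=> [_ [x0 mu_x0]] lf.
have mf := continuous_real_measurable (lip1_continuous lf).
have md := continuous_real_measurable (lip1_continuous (lip1_mdist x0)).
have id : mu.-integrable [set: borel X] (fun x => (mdist (x : X) x0)%:E).
  apply/integrableP; split; first exact/measurable_EFinP.
  by under eq_integral do rewrite gee0_abs ?lee_fin ?mdist_ge0//.
have ic : mu.-integrable [set: borel X] (EFin \o cst `|f x0|).
  exact: finite_measure_integrable_cst.
apply: (le_integrable measurableT _ _ (integrableD measurableT ic id)).
  exact/measurable_EFinP.
move=> x _ /=; rewrite lee_fin.
rewrite [leRHS]ger0_norm ?addr_ge0 ?mdist_ge0//.
rewrite -lerBlDl; apply: le_trans (lf x x0).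
exact: lerB_dist.
Qed.

Lemma dMK_has_sup (mu nu : probability (borel X) R) : P1 mu -> P1 nu ->
  has_sup [set \int[mu]_x f x - \int[nu]_x f x | f in @lip1 R X].
Proof.
move=> Pmu Pnu; split.
  exists (\int[mu]_x 0 - \int[nu]_x 0), (fun=> 0) => //.
  by move=> x y; rewrite subrr normr0 mdist_ge0.
pose x0 : X := point.
exists (\int[mu]_x mdist (x : X) x0 + \int[nu]_x mdist (x : X) x0).
move=> _ [f lf <-].
have ic (m : probability (borel X) R) :=
  @finite_measure_integrable_cst _ (borel X) R m setT (f x0).
have cI (m : probability (borel X) R) : \int[m]_x (f x0) = f x0.
  by rewrite Rintegral_cst//= probability_setT mulr1.
have ub (m : probability (borel X) R) : P1 m ->
    `|\int[m]_x f x - f x0| <= \int[m]_x mdist (x : X) x0.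
  move=> Pm; have If := lip1_integrable Pm lf.
  rewrite -{1}(cI m) -RintegralB//; last exact: ic.
  have Ifc : m.-integrable [set: borel X] (EFin \o (fun x => f x - f x0)).
    by rewrite (_ : _ \o _ = (EFin \o f) \- (EFin \o cst (f x0)))%E//;
      apply: integrableB => //; exact: ic.
  apply: (le_trans (le_normr_Rintegral measurableT Ifc)).
  apply: le_Rintegral => //; first exact: integrable_norm.
  exact: lip1_integrable (lip1_mdist x0).
have := ub _ Pmu; have := ub _ Pnu; rewrite !ler_norml.
move=> /andP[h1 _] /andP[_ h2].
rewrite -(subrKA (f x0)); apply: lerD => //.
by rewrite -opprB lerNl.
Qed.

End dMK_sup.

(* Main.v *)
(* The proof rests on the inequality
     sum_i p_i d(w_i x, w_i y) <= kappa d(x, y) + (1 - kappa) delta,   0 < kappa < 1,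
   valid for every scale [delta > 0] with a factor [kappa] depending on [delta].

   Contraction.  If [f] is 1-Lipschitz then [g = sum_i p_i (f o w_i)] is [kappa]-Lipschitz
   up to the error [(1 - kappa) delta].  Its inf-convolution with [kappa d] is exactly
   [kappa]-Lipschitz and lies within that error below [g], so that
   dMK (M mu) (M nu) <= kappa (dMK mu nu) + (1 - kappa) delta.  Taking [delta] half of
   [dMK mu nu] gives the Rakotch property without any coupling or duality theorem.

   Invariant measure.  Lebesgue measure on [0, 1) is the [p]-mixture of its images under
   the affine maps onto consecutive subintervals of lengths [p_i].  Reading off the digits
   of a point in this partition realises the backward compositions
   [w_(i_1) o ... o w_(i_n)] applied to a base point as random variables with finitely many
   values.  The same inequality makes them Cauchy in mean, so a subsequence converges almost
   surely; its limit has an invariant law, which is Radon because that law is tight.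

   Convergence.  The inequality also forces dMK (M^n mu) mu_star -> 0, hence integrals of
   Lipschitz functions converge, and bounded continuous functions are monotone limits of
   their inf-convolutions. *)
Require Import Defs.
From HB Require Import structures.
From mathcomp Require Import all_boot all_order all_algebra.
From mathcomp Require Import all_classical all_reals all_analysis.
From mathcomp Require Import measurable_realfun giry lra.

Import Order.TTheory GRing.Theory Num.Theory.
Import numFieldNormedType.Exports.

Set Implicit Arguments.
Unset Strict Implicit.
Unset Printing Implicit Defensive.

Local Open Scope classical_set_scope.
Local Open Scope ring_scope.

(** * Inf-convolutions and integrals *)

Section infconv.
Context {R : realType} {X : metricType R}.
Implicit Types (f : X -> R) (x y : X) (k e : R).

(** For [k >= 0] this is the largest [k]-Lipschitz minorant of [f] (Pasch-Hausdorff envelope). The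
    infimum is meaningful only over a set bounded below, which the lemmas ensure by taking [f] to be
    [k]-Lipschitz up to an additive error [e]. *)
Definition infconv k f x : R := inf [set f y + k * mdist x y | y in [set: X]].

Lemma infconv_has_inf k e f x : (forall x y, f x <= f y + k * mdist x y + e) ->
  has_inf [set f y + k * mdist x y | y in [set: X]].
Proof.
move=> fe; split; first by exists (f x + k * mdist x x), x.
by exists (f x - e) => _ [y _ <-]; rewrite lerBlDr.
Qed.

Lemma infconv_lb k e f x y : (forall x y, f x <= f y + k * mdist x y + e) ->
  infconv k f x <= f y + k * mdist x y.
Proof.
by move=> fe; apply: ge_inf; [exact: (infconv_has_inf x fe).2|exists y].
Qed.

Lemma infconv_le k e f x : (forall x y, f x <= f y + k * mdist x y + e) ->
  infconv k f x <= f x.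
Proof. by move=> /(infconv_lb x x); rewrite mdistxx mulr0 addr0. Qed.

Lemma le_infconv k f x c : (forall y, c <= f y + k * mdist x y) ->
  c <= infconv k f x.
Proof.
move=> cf; apply: lb_le_inf; first by exists (f x + k * mdist x x), x.
by move=> _ [y _ <-].
Qed.

Lemma infconv_ge k e f x : (forall x y, f x <= f y + k * mdist x y + e) ->
  f x - e <= infconv k f x.
Proof. by move=> fe; apply: le_infconv => y; rewrite lerBlDr. Qed.

Lemma infconv_lip k e f x y : 0 <= k ->
  (forall x y, f x <= f y + k * mdist x y + e) ->
  `|infconv k f x - infconv k f y| <= k * mdist x y.
Proof.
move=> k0 fe; have H u v : infconv k f u - k * mdist u v <= infconv k f v.
  apply: le_infconv => z; rewrite lerBlDr (le_trans (infconv_lb u z fe))//.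
  by rewrite -addrA lerD2l -mulrDr ler_wpM2l// addrC metric_triangle.
have := H x y; have := H y x; rewrite (metric_sym y x) ler_norml; lra.
Qed.

(** For bounded [f] the oscillation serves as the error at every slope, so all the lemmas above
    apply. *)
Lemma bounded_infconvP f (B : R) k : (forall x, `|f x| <= B) -> 0 <= k ->
  forall x y, f x <= f y + k * mdist x y + (B + B).
Proof.
move=> fB k0 x y; have := fB x; have := fB y; rewrite !ler_norml.
have : 0 <= k * mdist x y by rewrite mulr_ge0 ?mdist_ge0.
lra.
Qed.

Lemma infconv_bounded f (B : R) k x : (forall x, `|f x| <= B) -> 0 <= k ->
  `|infconv k f x| <= B.
Proof.
move=> fB k0; have fe := bounded_infconvP fB k0.
rewrite ler_norml (le_trans (infconv_le x fe)) ?andbT; last first.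
  by have := fB x; rewrite ler_norml => /andP[].
apply: le_infconv => y; have := fB y; rewrite ler_norml.
have : 0 <= k * mdist x y by rewrite mulr_ge0 ?mdist_ge0.
lra.
Qed.

(** Near [x] lower semicontinuity bounds [f y] from below; far from [x] the penalty outweighs the
    oscillation of [f]. *)
Lemma infconv_cvg f (B : R) x : (forall x, `|f x| <= B) ->
  (forall e, 0 < e -> \forall y \near x, f x - e <= f y) ->
  infconv n%:R f x @[n --> \oo] --> f x.
Proof.
move=> fB lsc; apply/(@cvgrPdist_le _ R^o) => e e0.
have [d /= d0 dP] : nbhs_ball_ (fun x d => [set y | mdist x y < d]) x
    [set y | f x - e <= f y].
  by rewrite metricType_numDomainType.nbhs_nbhs_mdist; exact: lsc.
near=> n; have n0 : 0 <= n%:R :> R by [].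
have fe := bounded_infconvP fB n0.
rewrite ger0_norm ?subr_ge0 ?(infconv_le x fe)//.
rewrite lerBlDr -lerBlDl; apply: le_infconv => y.
have [xyd|dxy] := ltP (mdist x y) d.
  have := dP _ xyd; have : 0 <= n%:R * mdist x y by rewrite mulr_ge0 ?mdist_ge0.
  by rewrite /=; lra.
(* A penalty of [2B] lifts the infimand to at least [B], hence above [f x]. *)
have nd : B + B <= n%:R * mdist x y.
  apply: (@le_trans _ _ (n%:R * d)); last by rewrite ler_wpM2l.
  by rewrite -ler_pdivrMr//; near: n; exact: nbhs_infty_ger.
have := fB x; have := fB y; rewrite !ler_norml; lra.
Unshelve. all: by end_near. Qed.

End infconv.

(** * Real-valued integrals: bounded functions and finite sums *)

Section Rintegral_lemmas.
Context d (T : measurableType d) (R : realType).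
Implicit Types P : probability T R.

Lemma bounded_integrable P (f : T -> R) (B : R) : measurable_fun setT f ->
  (forall x, `|f x| <= B) -> P.-integrable setT (EFin \o f).
Proof.
move=> mf fB; apply: measurable_bounded_integrable => //.
  by apply: le_lt_trans (probability_le1 P measurableT) _; rewrite ltry.
exists B; split; first exact: num_real.
by move=> x /ltW Bx y _ /=; exact: le_trans (fB y) Bx.
Qed.

Lemma bounded_cvg_Rintegral P (f_ : nat -> T -> R) (f : T -> R) (B : R) :
  (forall n, measurable_fun setT (f_ n)) -> measurable_fun setT f ->
  (forall n x, `|f_ n x| <= B) ->
  {ae P, forall x, f_ n x @[n --> \oo] --> f x} ->
  \int[P]_x f_ n x @[n --> \oo] --> \int[P]_x f x.
Proof.
move=> mf_ mf fB f_f.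
have [If _ cv] := @dominated_convergence _ T R P setT measurableT
  (fun n x => (f_ n x)%:E) (EFin \o f) (EFin \o cst B)
  (fun n => (measurable_EFinP _ _).2 (mf_ n)) ((measurable_EFinP _ _).2 mf)
  ltac:(by apply: filterS f_f => x fx _; exact/cvg_EFin/fx/nearW)
  (finite_measure_integrable_cst P B measurableT)
  ltac:(by apply: nearW => x n _; rewrite lee_fin).
apply: fine_cvg; rewrite fineK//; last exact: integrable_fin_num.
Qed.

Lemma integrable_sumr (mu : {measure set T -> \bar R}) (I : Type) (s : seq I)
    (f : I -> T -> R) : (forall i, mu.-integrable setT (EFin \o f i)) ->
  mu.-integrable setT (EFin \o (fun x => \sum_(i <- s) f i x)).
Proof.
move=> fi; elim: s => [|i s IH].
  by under eq_fun do rewrite big_nil; exact: integrable0.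
under eq_fun do rewrite big_cons.
exact: (integrableD measurableT (fi i) IH).
Qed.

Lemma Rintegral_sum (mu : {measure set T -> \bar R}) (I : Type) (s : seq I)
    (f : I -> T -> R) : (forall i, mu.-integrable setT (EFin \o f i)) ->
  \int[mu]_x (\sum_(i <- s) f i x) = \sum_(i <- s) \int[mu]_x f i x.
Proof.
move=> fi; elim: s => [|i s IH].
  rewrite big_nil; under eq_Rintegral do rewrite big_nil.
  by rewrite /Rintegral integral0.
rewrite big_cons -IH; under eq_Rintegral do rewrite big_cons.
by rewrite RintegralD//; exact: integrable_sumr.
Qed.

Lemma RintegralN (mu : {measure set T -> \bar R}) (f : T -> R) :
  mu.-integrable setT (EFin \o f) -> \int[mu]_x (- f x) = - \int[mu]_x f x.
Proof.
move=> If; rewrite -mulN1r -(RintegralZl (-1) measurableT If).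
by apply: eq_Rintegral => x _; rewrite mulN1r.
Qed.

End Rintegral_lemmas.

(** * Integrals against finite mixtures of push-forwards *)

Section mixture.
Context d1 d2 (S : measurableType d1) (T : measurableType d2) (R : realType).
Variables (m : {measure set T -> \bar R}) (mu : {measure set S -> \bar R}).
Variables (N : nat) (p : 'I_N -> R) (g : 'I_N -> S -> T).
Hypothesis p0 : forall i, 0 <= p i.
Hypothesis mg : forall i, measurable_fun setT (g i).
Hypothesis mE : forall A, measurable A ->
  m A = (\sum_(i < N) (p i)%:E * mu (g i @^-1` A))%E.

(** This section serves two mixtures: [markov_operator w mu] over the maps [w i], and Lebesgue
    measure on [0, 1) over the branches of the digit expansion. *)
Lemma ge0_integral_mixture (f : T -> \bar R) : measurable_fun setT f ->
  (forall x, 0 <= f x)%E ->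
  (\int[m]_x f x = \sum_(i < N) (p i)%:E * \int[mu]_x f (g i x))%E.
Proof.
move=> mf f0.
pose gm i : {measure set T -> \bar R} :=
  ltac:(refine (pushforward mu (g i)); exact: mg).
(* [msum] adds up a sequence indexed by natural numbers, hence the padding with [mzero] beyond
   [N]. *)
pose m_ n : {measure set T -> \bar R} := if insub n is Some i then
  mscale (NngNum (p0 i)) (gm i) else mzero.
rewrite (eq_measure_integral (msum m_ N)); last first.
  move=> A mA _; rewrite [LHS]mE//; apply: eq_bigr => i _.
  by rewrite /m_ valK.
rewrite ge0_integral_measure_sum//; apply: eq_bigr => i _.
by rewrite /m_ valK ge0_integral_mscale//= ge0_integral_pushforward.
Qed.

Lemma integrable_mixture (f : T -> R) : measurable_fun setT f ->
  (forall i, mu.-integrable setT (EFin \o (f \o g i))) ->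
  m.-integrable setT (EFin \o f).
Proof.
move=> mf fg; apply/integrableP; split; first exact/measurable_EFinP.
rewrite ge0_integral_mixture//; last first.
  by apply: measurableT_comp => //; exact/measurable_EFinP.
apply: lte_sum_pinfty => i _; apply: lte_mul_pinfty; rewrite ?lee_fin//.
by have /integrableP[] := fg i.
Qed.

Lemma Rintegral_mixture (f : T -> R) : measurable_fun setT f ->
  (forall i, mu.-integrable setT (EFin \o (f \o g i))) ->
  \int[m]_x f x = \sum_(i < N) p i * \int[mu]_x f (g i x).
Proof.
move=> mf fg.
have H (h : T -> R) : measurable_fun setT h -> (forall x, 0 <= h x) ->
    (forall i, mu.-integrable setT (EFin \o (h \o g i))) ->
    \int[m]_x h x = \sum_(i < N) p i * \int[mu]_x h (g i x).
  move=> mh h0 hg; rewrite /Rintegral ge0_integral_mixture//; last first.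
    exact/measurable_EFinP.
  rewrite -sum_fine => [|i _]; last first.
    by rewrite fin_numM//; exact: (integrable_fin_num measurableT (hg i)).
  by apply: eq_bigr => i _; rewrite fineM//;
    exact: (integrable_fin_num measurableT (hg i)).
pose a x := `|f x|.
have ma : measurable_fun setT a by exact: measurableT_comp.
have ag i : mu.-integrable setT (EFin \o (a \o g i)).
  exact: (integrable_norm (fg i)).
have Im := integrable_mixture mf fg; have Ia := integrable_mixture ma ag.
(* Both [f + |f|] and [|f|] are nonnegative; subtracting their formulas gives the one for [f]. *)
have e : \int[m]_x (f x + a x) = \sum_(i < N) p i * \int[mu]_x (f (g i x) + a (g i x)).
  apply: (H (fun x => f x + a x)); first exact: measurable_funD.
  - by move=> x; have := ler_norm (- f x); rewrite normrN /a; lra.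
  - by move=> i; exact: (integrableD measurableT (fg i) (ag i)).
have e' : \int[m]_x a x = \sum_(i < N) p i * \int[mu]_x a (g i x) by apply: H => // x; rewrite /a.
move: e; rewrite RintegralD// e' => /(canRL (addrK _)) ->.
rewrite -sumrB; apply: eq_bigr => i _.
rewrite RintegralD//; [|exact: fg|exact: ag].
by rewrite mulrDr addrK.
Qed.

End mixture.

(** * Radon measures and Lipschitz test functions *)

Section metric_topology.
Context {R : realType}.

Lemma open_mdistP (X : metricType R) (U : set X) :
  open U <-> forall x, U x -> exists2 e : R, 0 < e &
    forall y, mdist x y < e -> U y.
Proof.
rewrite openE; split => oU x Ux.
  have : nbhs x U by exact: oU.
  by rewrite -metricType_numDomainType.nbhs_nbhs_mdist => -[e e0 eU]; exists e.
have [e e0 eU] := oU x Ux.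
by rewrite /interior /= -metricType_numDomainType.nbhs_nbhs_mdist; exists e.
Qed.

(** An ultrafilter on [K] contains a ball of every radius, for otherwise it would contain the
    complements of finitely many balls covering [K]. It is therefore Cauchy, and its limit lies in
    the closed set [K]. *)
Lemma totally_bounded_compact (X : completeMetricType R) (K : set X) :
  closed K ->
  (forall e, 0 < e -> exists2 A : set X, finite_set A &
     K `<=` [set x | exists2 a, A a & mdist a x < e]) ->
  compact K.
Proof.
move=> cK tK; rewrite compact_ultra => F UF FK.
have /cauchy_exP/cauchy_cvg/cvg_ex[x Fx] : cauchy_ex F.
  move=> e e0; have [A /finite_fsetP[D AD] KA] := tK e e0.
  apply: contrapT => /forallNP nF; apply: (@filter_not_empty _ F).
  have FI : F (\bigcap_(a in A) ~` ball a e).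
    by rewrite AD; apply: filter_bigI => a _; have [/nF|] := in_ultra_setVsetC (ball a e) UF.
  apply: filterS (filterI FK FI) => y [Ky]; have [a Aa ay] := KA y Ky.
  by move=> /(_ a Aa); rewrite ballEmdist.
exists x; split => //; apply: cK => B /Fx FB.
by have [y []] := filter_ex (filterI FK FB); exists y.
Qed.

End metric_topology.

(** * Closed-open regularity of Borel probability measures; tight measures are Radon *)

Section borel_regularity.
Context {R : realType} {X : completeMetricType R}.
Variable mu : probability (borel X) R.
Local Open Scope ereal_scope.

Lemma closed_borel_measurable (K : set X) : closed K ->
  measurable (K : set (borel X)).
Proof.
by move=> cK; rewrite -[K]setCK; apply: measurableC; apply: open_borel_measurable;
  exact: closed_openC.
Qed.

(** The sets with this property form a sigma-algebra containing the open sets, hence they are all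
    the Borel sets. *)
Definition closed_open_approx (B : set (borel X)) :=
  measurable B /\ forall e : R, (0 < e)%R -> exists F U : set X,
    [/\ closed F, open U, F `<=` B, B `<=` U &
        mu ((U `\` F : set X) : set (borel X)) <= e%:E].

(** An open set is the increasing union of the closed sets [F n] of points at distance at least
    [1/(n+1)] from its complement; continuity from above makes the remainder small. *)
Lemma open_approx (U : set X) : open U -> closed_open_approx U.
Proof.
move=> oU; split=> [|e e0]; first exact: open_borel_measurable.
pose F n : set X := [set x | forall y, (mdist x y < n.+1%:R^-1)%R -> U y].
have cF n : closed (F n).
  rewrite -[F n]setCK; apply: open_closedC; apply/open_mdistP => x.
  move=> /existsNP[y /not_implyP[xy nUy]].
  exists (n.+1%:R^-1 - mdist x y)%R; first by rewrite subr_gt0.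
  move=> z xz; apply/existsNP; exists y; apply/not_implyP; split => //.
  rewrite (le_lt_trans (metric_triangle z x y))// (metric_sym z x).
  by rewrite -ltrBrDr.
have FU n : F n `<=` U by move=> x; apply; rewrite mdistxx invr_gt0.
have mF n : measurable (F n : set (borel X)) by exact: closed_borel_measurable.
have mU : measurable (U : set (borel X)) by exact: open_borel_measurable.
have FUE : \bigcap_n (U `\` F n) = set0.
  rewrite -subset0 => x Fx; have Ux : U x by have [] := Fx 0%N I.
  have [d d0 dU] := (open_mdistP U).1 oU x Ux.
  have [n /ltW dn] : exists n, (n.+1%:R^-1 < d)%R.
    by near \oo => n; exists n; near: n; exact: near_infty_natSinv_lt (PosNum d0).
  by have [_] := Fx n I; apply => y xy; apply: dU; exact: lt_le_trans dn.
have : mu (U `\` F n) @[n --> \oo] --> mu (\bigcap_n (U `\` F n)).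
  apply: (@nonincreasing_cvg_mu _ _ _ mu (fun n => U `\` F n)).
  - by rewrite (le_lt_trans (probability_le1 _ _)) ?ltry//; exact: measurableD.
  - by move=> n; exact: measurableD.
  - by rewrite FUE.
  - move=> m n mn; apply/subsetPset => x [Ux nF]; split => // Fx; apply: nF.
    move=> y xy; apply: Fx; apply: (lt_le_trans xy).
    by rewrite lef_pV2 ?posrE// ler_nat ltnS.
rewrite FUE measure0 => /fine_cvgP[_] /(@cvgrPdist_lt _ R^o) /(_ e e0) /=.
move=> /filter_ex[n]; rewrite sub0r normrN => /ltW ne.
exists (F n), U; split => //.
rewrite -[leLHS]fineK; last by apply: fin_num_measure; exact: measurableD.
by rewrite lee_fin (le_trans _ ne)// ler_norm.
Unshelve. all: by end_near. Qed.

Lemma closed_open_approxC B :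
  closed_open_approx B -> closed_open_approx (~` B).
Proof.
move=> [mB aB]; split=> [|e e0]; first exact: measurableC.
have [F [U [cF oU FB BU UFe]]] := aB e e0.
exists (~` U), (~` F); split; [exact: open_closedC|exact: closed_openC|..].
- exact: subsetC.
- exact: subsetC.
- by rewrite setDE setCK setIC -setDE.
Qed.

(** The outer sets unite to an open set, but only finitely many inner sets may be united if the
    result is to stay closed. Half of [e] pays for the gaps [U n \ F n], the other half for the
    inner sets left out. *)
Lemma closed_open_approx_bigcup (B : (set (borel X))^nat) :
  (forall n, closed_open_approx (B n)) -> closed_open_approx (\bigcup_n B n).
Proof.
move=> aB; split=> [|e e0]; first by apply: bigcupT_measurable => n; have [] := aB n.
have e2 : (0 < e / 2)%R by rewrite divr_gt0.
have /choice[F /choice[U FU]] n : exists F U : set X,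
    [/\ closed F, open U, F `<=` B n, B n `<=` U &
        mu ((U `\` F : set X) : set (borel X)) <= (e / 2 / (2 ^ n.+1)%:R)%:E].
  by apply: (aB n).2; rewrite divr_gt0// ltr0n expn_gt0.
have mF n : measurable (F n : set (borel X)).
  by apply: closed_borel_measurable; have [] := FU n.
have mU n : measurable (U n : set (borel X)).
  by apply: open_borel_measurable; have [] := FU n.
pose G n : set X := \bigcup_(i < n) F i.
have mG n : measurable (G n : set (borel X)).
  by apply: (@fin_bigcup_measurable _ (borel X)).
have mUF : measurable (\bigcup_n F n : set (borel X)) by exact: bigcupT_measurable.
have mUU : measurable (\bigcup_n U n : set (borel X)) by exact: bigcupT_measurable.
have GE : \bigcap_n (\bigcup_n F n `\` G n) = set0.
  rewrite -subset0 => x Gx; have [k _ Fkx] : (\bigcup_n F n) x by have [] := Gx 0%N I.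
  by have [_] := Gx k.+1 I; apply; exists k => /=.
have : mu (\bigcup_n F n `\` G n) @[n --> \oo] --> mu (\bigcap_n (\bigcup_n F n `\` G n)).
  apply: (@nonincreasing_cvg_mu _ _ _ mu (fun n => \bigcup_n F n `\` G n)).
  - by rewrite (le_lt_trans (probability_le1 _ _)) ?ltry//; exact: measurableD.
  - by move=> n; exact: measurableD.
  - by rewrite GE.
  - move=> m n mn; apply/subsetPset; apply: setDS => x [i /= im Fix].
    by exists i => //=; exact: leq_trans mn.
rewrite GE measure0 => /fine_cvgP[_] /(@cvgrPdist_lt _ R^o) /(_ _ e2) /=.
move=> /filter_ex[n]; rewrite sub0r normrN => /ltW ne.
exists (G n), (\bigcup_n U n); split.
- by apply: closed_bigcup => // i _; have [] := FU i.
- by apply: bigcup_open => i _; have [] := FU i.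
- by move=> x [i _ Fix]; exists i => //; have [_ _ + _ _] := FU i; exact.
- by move=> x [i _ Bix]; exists i => //; have [_ _ _ + _] := FU i; exact.
have sub : \bigcup_n U n `\` G n `<=`
    (\bigcup_n (U n `\` F n)) `|` (\bigcup_n F n `\` G n).
  move=> x [[i _ Uix] nG]; have [Fix|nF] := pselect (F i x).
    by right; split => //; exists i.
  by left; exists i.
have m1 : measurable (\bigcup_n (U n `\` F n) : set (borel X)).
  by apply: bigcupT_measurable => k; exact: measurableD.
have m2 : measurable (\bigcup_n F n `\` G n : set (borel X)) by exact: measurableD.
have h1 : mu (\bigcup_n (U n `\` F n)) <= (e / 2)%:E.
  apply: le_trans (epsilon_trick0 xpredT (ltW e2)).
  apply: (@le_trans _ _ (\sum_(n <oo) mu (U n `\` F n))).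
    by apply: measure_sigma_subadditive => // k; exact: measurableD.
  apply: lee_nneseries => // k _ //.
  by have [_ _ _ _ ?] := FU k.
have h2 : mu (\bigcup_n F n `\` G n) <= (e / 2)%:E.
  rewrite -[leLHS]fineK; last exact: fin_num_measure.
  by rewrite lee_fin (le_trans _ ne)// ler_norm.
rewrite [e]splitr EFinD; apply: le_trans (leeD h1 h2).
apply: le_trans (measureU2 mu m1 m2).
by apply: le_measure => //; rewrite inE; [exact: measurableD|exact: measurableU].
Qed.

Lemma borel_closed_open_approx B : measurable B -> closed_open_approx B.
Proof.
move=> mB; apply: (@smallest_sub _ _ _ closed_open_approx) mB.
- split.
  + by apply: open_approx; exact: open0.
  + by move=> A aA; rewrite setTD; exact: closed_open_approxC.
  + exact: closed_open_approx_bigcup.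
- by move=> U oU; exact: open_approx.
Qed.

(** With [F] closed inside [B], [U] open around it and [K] compact, the set [K] meets [F] in a
    compact subset of [B], and what is lost lies in the complement of [K] or in [U \ F]. *)
Lemma tight_radon :
  (forall e : R, (0 < e)%R -> exists2 K : set X, compact K &
     mu (~` (K : set (borel X))) <= e%:E) ->
  radon mu.
Proof.
move=> tight B mB.
have mK (K : set X) : compact K -> measurable (K : set (borel X)).
  move=> cK; apply: closed_borel_measurable.
  by apply: compact_closed cK; exact: metric_hausdorff.
apply/eqP; rewrite eq_le; apply/andP; split; last first.
  apply: ge_ereal_sup => _ [K [cK KB] <-].
  by apply: le_measure; [rewrite inE; exact: mK|rewrite inE|exact: KB].
apply/lee_addgt0Pr => e e0; have e2 : (0 < e / 2)%R by rewrite divr_gt0.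
have [K cK Ke] := tight _ e2.
have [F [U [cF oU FB BU UFe]]] := (borel_closed_open_approx mB).2 _ e2.
have mF := closed_borel_measurable cF; have mU := open_borel_measurable oU.
have cKF : compact (K `&` F) by exact: compact_closedI.
apply: (@le_trans _ _ (mu (K `&` F) + e%:E)); last first.
  rewrite leeD2r//; apply: ereal_sup_ubound; exists (K `&` F) => //; split => //.
  by move=> x [_ /FB].
have mKC : measurable (~` K : set (borel X)) by apply: measurableC; exact: mK.
have mKF : measurable (K `&` F : set (borel X)) by exact: mK.
have mUF : measurable (U `\` F : set (borel X)) by exact: measurableD.
apply: (@le_trans _ _ (mu ((K `&` F) `|` (~` K `|` (U `\` F))))).
  apply: le_measure; rewrite ?inE//.
    by apply: measurableU => //; exact: measurableU.
  move=> x Bx; have [Kx|nK] := pselect (K x); last by right; left.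
  have [Fx|nF] := pselect (F x); first by left.
  by right; right; split => //; exact: BU.
have mKUF : measurable (~` K `|` (U `\` F) : set (borel X)) by exact: measurableU.
apply: (le_trans (measureU2 mu mKF mKUF)); rewrite leeD2l//.
rewrite [e]splitr EFinD; apply: le_trans (leeD Ke UFe).
exact: measureU2.
Qed.

End borel_regularity.

(** * Bounded Lipschitz functions determine measures and weak convergence *)

Section lipschitz_test_functions.
Context {R : realType} {X : completeMetricType R}.

Definition lipschitz_fun (k : R) (f : X -> R) :=
  forall x y, `|f x - f y| <= k * mdist x y.

Lemma lipschitz_fun_lip1 (k : R) (f : X -> R) : 0 < k -> lipschitz_fun k f ->
  lip1 (fun x => k^-1 * f x).
Proof.
move=> k0 fk x y; rewrite -mulrBr normrM gtr0_norm ?invr_gt0//.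
by rewrite ler_pdivrMl// mulrC.
Qed.

Lemma lipschitz_fun_continuous (k : R) (f : X -> R) : 0 < k ->
  lipschitz_fun k f -> continuous f.
Proof.
move=> k0 fk; have -> : f = (fun x => k * (k^-1 * f x)).
  by apply/funext => x; rewrite mulrA divff ?mul1r// gt_eqF.
move=> x; apply: (@cvgM R X (nbhs x) _ (cst k)); first exact: cvg_cst.
exact: (lip1_continuous (lipschitz_fun_lip1 k0 fk)).
Qed.

Lemma lipschitz_fun_measurable (k : R) (f : X -> R) : 0 < k ->
  lipschitz_fun k f -> measurable_fun [set: borel X] f.
Proof.
move=> k0 fk; apply: continuous_real_measurable.
exact: lipschitz_fun_continuous fk.
Qed.

(** The shift to [n.+1] keeps the Lipschitz constant positive, so that it can be divided out. *)
Lemma infconv_lipschitz_fun n (f : X -> R) (B : R) : (forall x, `|f x| <= B) ->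
  lipschitz_fun n.+1%:R (infconv n.+1%:R f).
Proof.
move=> fB x y; apply: (infconv_lip x y _ (bounded_infconvP fB _)) => //.
Qed.

(** Lower semicontinuity covers both uses: indicators of open sets and bounded continuous
    functions. *)
Lemma infconv_cvg_Rintegral (mu : probability (borel X) R) (f : X -> R) (B : R) :
  (forall x, `|f x| <= B) -> measurable_fun [set: borel X] f ->
  (forall x e, 0 < e -> \forall y \near x, f x - e <= f y) ->
  \int[mu]_x infconv n.+1%:R f x @[n --> \oo] --> \int[mu]_x f x.
Proof.
move=> fB mf lsc; apply: (@bounded_cvg_Rintegral _ _ _ _ _ _ B) => //.
- by move=> n; apply: lipschitz_fun_measurable (infconv_lipschitz_fun n fB).
- by move=> n x; exact: infconv_bounded.
- apply: nearW => x; have := infconv_cvg fB (lsc x).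
  by rewrite -(cvg_shiftS (fun n => infconv n%:R f x)).
Qed.

(** The indicator of an open set is lower semicontinuous, hence a limit of bounded Lipschitz
    functions. The measures thus agree on open sets, a generating family closed under
    intersection. *)
Lemma eq_lipschitz_measure (mu nu : probability (borel X) R) :
  (forall (k B : R) h, 0 < k -> lipschitz_fun k h -> (forall x, `|h x| <= B) ->
     \int[mu]_x h x = \int[nu]_x h x) ->
  mu ≡μ nu.
Proof.
move=> H A mA; apply: (@g_sigma_algebra_measure_unique _ R (borel X) (@open X)
   _ (fun=> setT)) => //.
- by move=> U oU; exact: open_borel_measurable.
- by move=> _; exact: openT.
- by rewrite -subTset => x _; exists 0%N.
- exact: openI.
- move=> U oU; have mU : measurable (U : set (borel X)) by exact: open_borel_measurable.
  have B1 x : `|\1_U x : R| <= 1 by rewrite indicE; case: (_ \in _); rewrite ?normr0 ?normr1.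
  have lsc (x : X) (e : R) : 0 < e -> \forall y \near x, (\1_U x : R) - e <= \1_U y.
    move=> e0; have [Ux|nUx] := pselect (U x).
      near=> y; have Uy : U y by near: y; exact: open_nbhs_nbhs.
      by rewrite !indicE !mem_set//= lerBlDr lerDl ltW.
    by near=> y; rewrite indicE memNset//= indicE (@le_trans _ _ 0)// sub0r lerNl oppr0 ltW.
  have mI : measurable_fun [set: borel X] (\1_U : borel X -> R) by exact: measurable_indic.
  have c1 := infconv_cvg_Rintegral (mu := mu) B1 mI lsc.
  have := infconv_cvg_Rintegral (mu := nu) B1 mI lsc.
  rewrite (_ : (fun n => \int[nu]_x _) = (fun n => \int[mu]_x infconv n.+1%:R \1_U x)).
    move=> c2; have := cvg_unique _ c2 c1; rewrite /Rintegral.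
    rewrite !integral_indic// !setIT => /(_ (@Rhausdorff R)) e.
    by rewrite -[LHS]fineK ?fin_num_measure// -[RHS]fineK ?fin_num_measure// e.
  apply/funext => n; apply/esym/(H n.+1%:R 1) => //.
    exact: infconv_lipschitz_fun B1.
  by move=> x; exact: infconv_bounded.
- by move=> _; rewrite (le_lt_trans (probability_le1 _ _)) ?ltry.
Unshelve. all: by end_near. Qed.

(** Lipschitz minorants give a lower bound for the limit inferior of the integrals of [f]; the same
    bound for [- f] controls the limit superior. *)
Lemma lipschitz_weak_cvg (mu_ : nat -> probability (borel X) R)
    (mu : probability (borel X) R) :
  (forall (k B : R) h, 0 < k -> lipschitz_fun k h -> (forall x, `|h x| <= B) ->
     \int[mu_ n]_x h x @[n --> \oo] --> \int[mu]_x h x) ->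
  weak_cvg mu_ mu.
Proof.
move=> H.
have low (f : X -> R) (B e : R) : continuous f -> (forall x, `|f x| <= B) ->
    0 < e -> \forall n \near \oo, \int[mu]_x f x - e <= \int[mu_ n]_x f x.
  move=> cf fB e0; have mf := continuous_real_measurable cf.
  have lsc (x : X) (d : R) : 0 < d -> \forall y \near x, f x - d <= f y.
    move=> d0; have /(@cvgrPdist_le _ R^o) /(_ d d0) := cf x.
    by apply: filterS => y; rewrite ler_norml; lra.
  have e2 : 0 < e / 2 by rewrite divr_gt0.
  (* The slope [k] is chosen from the limit [mu] alone, so the hypothesis applies to one fixed test
     function. *)
  have /(@cvgrPdist_le _ R^o) /(_ _ e2) /filter_ex[k] := infconv_cvg_Rintegral (mu := mu) fB mf lsc.
  rewrite ler_norml => /andP[_ k1].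
  have lk := infconv_lipschitz_fun k fB.
  have bk x : `|infconv k.+1%:R f x| <= B by exact: infconv_bounded.
  have k0 : 0 < k.+1%:R :> R by [].
  have /(@cvgrPdist_le _ R^o) /(_ _ e2) := H _ _ _ k0 lk bk.
  apply: filterS => n; rewrite ler_norml => /andP[_ k2].
  have : \int[mu_ n]_x infconv k.+1%:R f x <= \int[mu_ n]_x f x.
    apply: le_Rintegral => //.
    - by apply: bounded_integrable (bk : forall x : borel X, _); apply: lipschitz_fun_measurable lk.
    - exact: (@bounded_integrable _ (borel X) _ _ _ B).
    - by move=> x _; exact: infconv_le (bounded_infconvP fB _).
  lra.
(* [bounded_fun] provides every bound strictly beyond [M], in particular [|M| + 1]. *)
move=> f cf [M [_ bf]]; have fB x : `|f x| <= `|M| + 1.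
  by apply: bf => //; rewrite (le_lt_trans (ler_norm M))// ltrDl.
have mf := continuous_real_measurable cf.
have If (m : probability (borel X) R) := @bounded_integrable _ (borel X) _ m _ _ mf fB.
apply/(@cvgrPdist_le _ R^o) => e e0.
have NfE (m : probability (borel X) R) : \int[m]_x (- f x) = - \int[m]_x f x.
  by rewrite RintegralN//; exact: If.
have cNf : continuous (fun x => - f x) by move=> x; apply: cvgN; exact: cf.
have NfB x : `|- f x| <= `|M| + 1 by rewrite normrN.
have := low _ _ _ cNf NfB e0; have := low _ _ _ cf fB e0.
apply: filterS2 => n; rewrite !NfE ler_norml; lra.
Qed.

End lipschitz_test_functions.

(** * The Markov operator is a Rakotch contraction *)

Section lipschitz_integrals.
Context {R : realType} {X : completeMetricType R}.
Implicit Types mu nu : probability (borel X) R.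

Lemma lipschitz_integrable mu (k : R) (h : X -> R) : P1 mu -> 0 < k ->
  lipschitz_fun k h -> mu.-integrable [set: borel X] (EFin \o h).
Proof.
move=> Pmu k0 hk; have := lip1_integrable Pmu (lipschitz_fun_lip1 k0 hk).
move=> /(integrableZl measurableT k); apply: eq_integrable => // x _ /=.
by rewrite -EFinM mulrA divff ?mul1r// gt_eqF.
Qed.

Lemma lip1_dMK mu nu (h : X -> R) : P1 mu -> P1 nu -> lip1 h ->
  \int[mu]_x h x - \int[nu]_x h x <= dMK mu nu.
Proof.
by move=> Pmu Pnu h1; apply: ub_le_sup; [exact: (dMK_has_sup Pmu Pnu).2|exists h].
Qed.

Lemma dMK_le mu nu (c : R) :
  (forall h, lip1 h -> \int[mu]_x h x - \int[nu]_x h x <= c) -> dMK mu nu <= c.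
Proof.
move=> H; apply: ge_sup; last by move=> _ [h /H + <-].
exists (\int[mu]_x 0 - \int[nu]_x 0), (fun=> 0) => //.
by move=> x y; rewrite subrr normr0 mdist_ge0.
Qed.

Lemma dMK_ge0 mu nu : P1 mu -> P1 nu -> 0 <= dMK mu nu.
Proof.
move=> Pmu Pnu; have l0 : lip1 (fun _ : X => 0 : R).
  by move=> x y; rewrite subrr normr0 mdist_ge0.
have := lip1_dMK Pmu Pnu l0.
by rewrite !Rintegral_cst// !mul0r subrr.
Qed.

Lemma lipschitz_dMK mu nu (k : R) (h : X -> R) : P1 mu -> P1 nu -> 0 < k ->
  lipschitz_fun k h -> \int[mu]_x h x - \int[nu]_x h x <= k * dMK mu nu.
Proof.
move=> Pmu Pnu k0 hk; rewrite -ler_pdivrMl//.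
have := lip1_dMK Pmu Pnu (lipschitz_fun_lip1 k0 hk).
have Zl m : P1 m -> \int[m]_x (k^-1 * h x) = k^-1 * \int[m]_x h x.
  by move=> Pm; rewrite RintegralZl//; exact: lipschitz_integrable hk.
by rewrite !Zl// -mulrBr.
Qed.

End lipschitz_integrals.

Section average_rakotch.
Context {R : realType} {X : completeMetricType R} {N : nat}.
Variable w : pifs R X N.
Hypothesis hw : average_rakotch w.
Local Notation p := (pifs_weight w).

(** A common Lipschitz constant, used only for integrability and for a crude bound on [transfer].
    The summand [1] makes it positive without inspecting [N]. *)
Lemma average_rakotch_lipschitz : exists2 c : R, 0 < c &
  forall i x y, mdist (w i x) (w i y) <= c * mdist x y.
Proof.
have [c [c0 _ lam]] := hw.
exists (\sum_(i < N) c i + 1) => [|i x y].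
  by rewrite ltr_wpDl// sumr_ge0// => i _; exact: ltW.
have [l [_ _ lc wl]] := lam i; apply: (le_trans (wl x y)).
(* The bound of the modulus by [c i] is available only at positive distances. *)
have [->|xy] := eqVneq x y; first by rewrite mdistxx !mulr0.
rewrite ler_wpM2r ?mdist_ge0// (le_trans (ltW (lc _ _))) ?mdist_gt0//.
rewrite (bigD1 i)//= -addrA lerDl addr_ge0// sumr_ge0// => j _; exact: ltW.
Qed.

(* The affine majorant of the averaged modulus [t * lambda t]: pairs at distance
   at least [d] are contracted by the factor [kappa d], and closer pairs are at
   least not spread apart. *)
Lemma average_rakotch_affine : exists kappa : R -> R,
  [/\ forall d, 0 < d -> 0 < kappa d < 1,
      forall s t, 0 < s -> s <= t -> kappa t <= kappa s &
      forall d, 0 < d -> forall x y,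
        \sum_(i < N) p i * mdist (w i x) (w i y)
        <= kappa d * mdist x y + (1 - kappa d) * d].
Proof.
have [c [c0 pc lam]] := hw; have [l lP] := choice lam.
pose L t := \sum_(i < N) p i * l i t.
have p0 i : 0 <= p i by rewrite ltW// pifs_weight_gt0.
(* The strict inequality [L t < 1] needs at least one summand. *)
have N0 : (0 < N)%N.
  case: (posnP N) => // N0; have := pifs_weight_sum w.
  rewrite big1 => [/eqP|[i iN]]; first by rewrite eq_sym oner_eq0.
  by have : (i < 0)%N by rewrite -N0.
have L1 t : 0 < t -> L t < 1.
  move=> t0; apply: lt_le_trans pc; apply: ltr_sum.
    by apply/hasP; exists (Ordinal N0); rewrite ?mem_index_enum.
  by move=> i _; rewrite ltr_pM2l ?pifs_weight_gt0//; have [_ _ ->] := lP i.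
have L0 t : 0 <= t -> 0 <= L t.
  by move=> t0; apply: sumr_ge0 => i _; rewrite mulr_ge0//; have [->] := lP i.
have Lni s t : 0 <= s -> s <= t -> L t <= L s.
  by move=> s0 st; apply: ler_sum => i _; rewrite ler_wpM2l//; have [_ ->] := lP i.
have wL x y : \sum_(i < N) p i * mdist (w i x) (w i y) <= L (mdist x y) * mdist x y.
  rewrite mulr_suml; apply: ler_sum => i _; rewrite -mulrA ler_wpM2l//.
  by have [_ _ _ ->] := lP i.
(* [L d] itself may vanish; averaging it with [1] gives a factor strictly between 0 and 1 that still
   dominates [L d]. *)
exists (fun d => (1 + L d) / 2); split.
- by move=> d d0; have := L1 _ d0; have := L0 _ (ltW d0); lra.
- by move=> s t s0 st; have := Lni _ _ (ltW s0) st; lra.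
- move=> d d0 x y; apply: (le_trans (wL x y)).
  have := L1 _ d0; have := L0 _ (ltW d0) => Ld0 Ld1.
  have [->|xy] := eqVneq x y.
    by rewrite mdistxx !mulr0 add0r mulr_ge0//; lra.
  have m0 : 0 < mdist x y by rewrite mdist_gt0.
  have [dm|md] := leP d (mdist x y).
    apply: (@le_trans _ _ ((1 + L d) / 2 * mdist x y)).
      by rewrite ler_wpM2r ?mdist_ge0//; have := Lni _ _ (ltW d0) dm; lra.
    by rewrite lerDl mulr_ge0//; lra.
  have : L (mdist x y) * mdist x y <= mdist x y.
    by rewrite ler_piMl ?mdist_ge0// ltW// L1.
  (* Below the scale [d], write the distance [m] as [kappa m + (1 - kappa) m] and enlarge the last
     [m] to [d]. *)
  have : 0 <= (1 - (1 + L d) / 2) * (d - mdist x y) by rewrite mulr_ge0//; lra.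
  lra.
Qed.

Lemma pifs_measurable i : measurable_fun [set: borel X] (w i : borel X -> borel X).
Proof. by apply: continuous_borel_measurable; exact: pifs_continuous. Qed.

Let p0 i : 0 <= p i. Proof. by rewrite ltW// pifs_weight_gt0. Qed.

Lemma pifs_integrable (mu : probability (borel X) R) (k : R) h i :
  P1 mu -> 0 < k -> lipschitz_fun k h ->
  mu.-integrable [set: borel X] (EFin \o (h \o w i)).
Proof.
move=> Pmu k0 hk; have [c c0 wc] := average_rakotch_lipschitz.
apply: (@lipschitz_integrable _ _ _ (k * c)) => //; first by rewrite mulr_gt0.
by move=> x y; rewrite (le_trans (hk _ _))// -mulrA ler_wpM2l// ltW.
Qed.

(** The dual of the Markov operator, acting on test functions. *)
Definition transfer (h : X -> R) (x : X) : R := \sum_(i < N) p i * h (w i x).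

Lemma transfer_lipschitz : exists2 c : R, 0 < c &
  forall k h, 0 < k -> lipschitz_fun k h -> lipschitz_fun (k * c) (transfer h).
Proof.
have [c c0 wc] := average_rakotch_lipschitz; exists c => // k h k0 hk x y.
rewrite /transfer -sumrB; apply: le_trans (ler_norm_sum _ _ _) _.
rewrite -[leRHS]mul1r -(pifs_weight_sum w) mulr_suml; apply: ler_sum => i _.
rewrite -mulrBr normrM (ger0_norm (p0 i)) ler_wpM2l// (le_trans (hk _ _))//.
by rewrite -mulrA ler_wpM2l// ltW.
Qed.

Lemma transfer_bounded (B : R) h : (forall x, `|h x| <= B) ->
  forall x, `|transfer h x| <= B.
Proof.
move=> hB x; rewrite /transfer; apply: le_trans (ler_norm_sum _ _ _) _.
rewrite -[leRHS]mul1r -(pifs_weight_sum w) mulr_suml; apply: ler_sum => i _.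
by rewrite normrM (ger0_norm (p0 i)) ler_wpM2l.
Qed.

Lemma Rintegral_markov_operator (mu : probability (borel X) R) (k : R) h :
  P1 mu -> 0 < k -> lipschitz_fun k h ->
  \int[markov_operator w mu]_x h x = \int[mu]_x transfer h x.
Proof.
move=> Pmu k0 hk; have hi i := pifs_integrable i Pmu k0 hk.
rewrite Rintegral_sum; last first.
  by move=> i; exact: (integrableZl measurableT (p i) (hi i)).
rewrite (@Rintegral_mixture _ _ (borel X) (borel X) _ _ mu _ p
    (w : 'I_N -> borel X -> borel X))//.
- by apply: eq_bigr => i _; rewrite RintegralZl//; exact: hi.
- exact: pifs_measurable.
- exact: lipschitz_fun_measurable hk.
Qed.

(** Choose a compact [K i] inside each preimage of [B], with loss at most [e]. The union of the
    images [w i (K i)] is compact and lies in [B], and the losses average to [e] because the weights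
    sum to 1. *)
Lemma markov_operator_radon (mu : probability (borel X) R) :
  radon mu -> radon (markov_operator w mu).
Proof.
move=> rmu B mB.
have mK (K : set X) : compact K -> measurable (K : set (borel X)).
  move=> cK; apply: closed_borel_measurable.
  by apply: compact_closed cK; exact: metric_hausdorff.
apply/eqP; rewrite eq_le; apply/andP; split; last first.
  apply: ge_ereal_sup => _ [K [cK KB] <-].
  by apply: le_measure; [rewrite inE; exact: mK|rewrite inE|exact: KB].
apply/lee_addgt0Pr => e e0.
have mwB i : measurable (w i @^-1` B : set (borel X)).
  by rewrite -[X in measurable X]setTI; exact: pifs_measurable.
have /choice[K KP] i : exists K : set X, [/\ compact K, K `<=` w i @^-1` B &
    (mu (w i @^-1` B) <= mu K + e%:E)%E].
  have fB : mu (w i @^-1` B) \is a fin_num by exact: fin_num_measure.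
  have := fB; rewrite {1}(rmu _ (mwB i)) => fS.
  have [_ [K [cK KB] <-] Ke] := ub_ereal_sup_adherent e0 fS.
  exists K; split => //; rewrite -leeBlDr//; apply: ltW.
  by rewrite (rmu _ (mwB i)).
pose C := \big[setU/set0]_(i < N) (w i @` K i).
have cC : compact C.
  apply: bigsetU_compact => i _; apply: continuous_compact; last by have [] := KP i.
  exact/continuous_subspaceT/pifs_continuous.
have mC := mK _ cC.
apply: (@le_trans _ _ (markov_operator w mu C + e%:E)%E); last first.
  rewrite leeD2r//; apply: ereal_sup_ubound; exists C => //; split => //.
  move=> x; rewrite /C -bigcup_seq => -[i _ [y Kiy <-]].
  by have [_ + _] := KP i; exact.
have -> : (e%:E = \sum_(i < N) (p i)%:E * e%:E)%E.
  by rewrite -ge0_sume_distrl ?sumEFin ?pifs_weight_sum ?mul1e// => i _; rewrite lee_fin.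
rewrite -big_split/=; apply: lee_sum => i _.
have C0 : (0 <= pushforward mu (w i : borel X -> borel X) C)%E by exact: (measure_ge0 mu (w i @^-1` C)).
rewrite -ge0_muleDr ?lee_fin ?(ltW e0)//; apply: lee_wpmul2l; rewrite ?lee_fin//.
have [cK KB Ke] := KP i; apply: (le_trans Ke); rewrite leeD2r//.
apply: le_measure; rewrite ?inE; [exact: mK|..].
  by rewrite -[X in measurable X]setTI; exact: pifs_measurable.
by move=> x Kx; rewrite /C -bigcup_seq; exists i; [exact: mem_index_enum|exists x].
Qed.

Lemma markov_operator_P1 (mu : probability (borel X) R) :
  P1 mu -> P1 (markov_operator w mu).
Proof.
move=> Pmu; split; first by apply: markov_operator_radon; case: Pmu.
pose x0 : X := point; exists x0.
have l1 : lipschitz_fun 1 (fun x : X => mdist x x0).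
  by move=> x y; rewrite mul1r; exact: lip1_mdist.
have : (markov_operator w mu).-integrable [set: borel X]
    (EFin \o (fun x : X => mdist x x0)).
  apply: (@integrable_mixture _ _ (borel X) (borel X) _ _ mu _ p (w : 'I_N -> borel X -> borel X)) => //.
  - exact: pifs_measurable.
  - exact: lipschitz_fun_measurable l1.
  - by move=> i; exact: pifs_integrable l1.
move=> /integrableP[_]; under eq_integral do rewrite gee0_abs ?lee_fin ?mdist_ge0//.
by [].
Qed.

Lemma markov_operator_dMK (kap d : R) (mu nu : probability (borel X) R) :
  0 < kap < 1 -> 0 < d ->
  (forall x y, \sum_(i < N) p i * mdist (w i x) (w i y)
               <= kap * mdist x y + (1 - kap) * d) ->
  P1 mu -> P1 nu ->
  dMK (markov_operator w mu) (markov_operator w nu)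
  <= kap * dMK mu nu + (1 - kap) * d.
Proof.
move=> /andP[k0 k1] d0 wk Pmu Pnu; apply: dMK_le => f f1.
have fl : lipschitz_fun 1 f by move=> x y; rewrite mul1r.
rewrite !(@Rintegral_markov_operator _ 1)//; set g := transfer f.
have gk x y : g x <= g y + kap * mdist x y + (1 - kap) * d.
  rewrite -addrA -lerBlDl; apply: le_trans (wk x y).
  rewrite -sumrB; apply: ler_sum => i _; rewrite -mulrBr ler_wpM2l//.
  exact: le_trans (ler_norm _) (f1 _ _).
have lh : lipschitz_fun kap (infconv kap g).
  by move=> x y; apply: infconv_lip gk; exact: ltW.
have Ig m : P1 m -> m.-integrable [set: borel X] (EFin \o g).
  have [c c0 gc] := transfer_lipschitz.
  by move=> Pm; apply: (@lipschitz_integrable _ _ _ (1 * c)); [|rewrite mul1r|exact: gc].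
have Ih m : P1 m -> m.-integrable [set: borel X] (EFin \o infconv kap g).
  by move=> Pm; exact: lipschitz_integrable lh.
(* The envelope replaces [transfer f] under both integrals: for [nu] it lies below, for [mu] it
   costs the error [(1 - kap) d]. *)
have := lipschitz_dMK Pmu Pnu k0 lh.
have : \int[nu]_x infconv kap g x <= \int[nu]_x g x.
  apply: le_Rintegral => //; [exact: Ih|exact: Ig|].
  by move=> x _; exact: infconv_le gk.
have Ic : mu.-integrable [set: borel X] (EFin \o cst ((1 - kap) * d)).
  exact: finite_measure_integrable_cst.
have : \int[mu]_x g x <= \int[mu]_x (infconv kap g x + (1 - kap) * d).
  apply: le_Rintegral => //; [exact: Ig|exact: (integrableD measurableT (Ih _ Pmu) Ic)|].
  by move=> x _; have := infconv_ge x gk; rewrite lerBlDr.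
rewrite RintegralD//; last exact: Ih.
rewrite Rintegral_cst//= probability_setT mulr1; lra.
Qed.

Lemma markov_operator_rakotch :
  rakotch_contraction (@P1 R X) (@dMK R X) (markov_operator w).
Proof.
split; first exact: markov_operator_P1.
have [kap [k01 kni wk]] := average_rakotch_affine.
(* At scale [d = t/2] the bound [kap t + (1 - kap) t/2] equals [(1 + kap)/2] times [t]. At 0 nothing
   is known of [kap], and the value is 1. *)
exists (fun t => if 0 < t then (1 + kap (t / 2)) / 2 else 1); split.
- move=> t t0; case: ifPn => [{}t0|_]; last by lra.
  have := k01 (t / 2); rewrite divr_gt0// => /(_ isT); lra.
- move=> s t s0 st; case: ifPn => [t0|t0].
    case: ifPn => [{}s0|_].
      by have := kni (s / 2) (t / 2); rewrite divr_gt0// ler_pM2r// => /(_ isT st); lra.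
    by have := k01 (t / 2); rewrite divr_gt0// => /(_ isT); lra.
  by rewrite ifN// -leNgt (le_trans st)// leNgt.
- by move=> t t0; rewrite t0; have := k01 (t / 2); rewrite divr_gt0// => /(_ isT); lra.
- move=> mu nu Pmu Pnu; have D0 := dMK_ge0 Pmu Pnu.
  have H e : 0 < e -> dMK (markov_operator w mu) (markov_operator w nu)
      <= kap e * dMK mu nu + (1 - kap e) * e.
    by move=> e0; apply: markov_operator_dMK => //; [exact: k01|exact: wk].
  case: ifPn => [r0|r0].
    by have := H _ (divr_gt0 r0 (ltr0n _ 2)); lra.
  have -> : dMK mu nu = 0 by apply/eqP; rewrite eq_le D0 leNgt r0.
  (* At distance 0 no scale is distinguished; every [e] bounds the new distance by
     [(1 - kap e) e]. *)
  rewrite mulr0; apply/ler_addgt0Pr => e e0; rewrite add0r.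
  have := H e e0; have -> : dMK mu nu = 0 by apply/eqP; rewrite eq_le D0 leNgt r0.
  rewrite mulr0 add0r => /le_trans; apply; rewrite ler_piMl ?(ltW e0)//.
  by have := k01 e e0; lra.
Qed.

End average_rakotch.

(** * Self-similarity of Lebesgue measure on the unit interval *)

Section unit_interval.
Context {R : realType}.
Local Open Scope ereal_scope.

Let mD : measurable (`[0%R, 1%R[%classic : set (measurableTypeR R)).
Proof. exact: measurable_itv. Qed.

(** A measure on the whole line, so that the affine maps stay total; points outside [0, 1) form a
    null set. *)
Definition unit_lebesgue : set (measurableTypeR R) -> \bar R :=
  mrestr lebesgue_measure mD.

HB.instance Definition _ := Measure.on unit_lebesgue.

Let unit_lebesgue_setT : unit_lebesgue setT = 1.
Proof.
by rewrite /unit_lebesgue /mrestr setTI lebesgue_measure_itv/= lte_fin ltr01 oppr0 adde0.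
Qed.

HB.instance Definition _ :=
  Measure_isProbability.Build _ _ _ unit_lebesgue unit_lebesgue_setT.

Definition affine (q p x : R) : R := (q + p * x)%R.

Lemma measurable_affine q p :
  measurable_fun setT (affine q p : measurableTypeR R -> measurableTypeR R).
Proof. by apply: measurable_funD => //; exact: measurable_funM. Qed.

(** Both sides are measures in [A] that agree on half-open intervals, which determine Lebesgue
    measure. *)
Lemma lebesgue_measure_affine (q p : R) (A : set (measurableTypeR R)) :
  (0 < p)%R -> measurable A ->
  lebesgue_measure A = p%:E * lebesgue_measure (affine q p @^-1` A).
Proof.
move=> p0; pose m : {measure set (measurableTypeR R) -> \bar R} :=
  ltac:(refine (pushforward lebesgue_measure (affine q p : measurableTypeR R -> measurableTypeR R)); exact: measurable_affine).
move=> mA; have -> // := @lebesgue_measure_unique R (mscale (NngNum (ltW p0)) m).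
move=> _ [[a b]] _ <- /=; rewrite /mscale/= /m/= /pushforward.
rewrite (_ : affine q p @^-1` _ = `](a - q) / p, (b - q) / p]%classic)%R; last first.
  apply/seteqP; split => x /=; rewrite !in_itv/= /affine;
    by rewrite ltr_pdivrMr// ler_pdivlMr// ltrBlDl lerBrDl (mulrC x).
rewrite !lebesgue_measure_itv/= !lte_fin ltr_pM2r ?invr_gt0// ltrD2r.
case: ifPn => _; last by rewrite mule0.
by rewrite -EFinD -EFinM -mulrBl mulrC divfK ?gt_eqF//; congr EFin; lra.
Qed.

Context {N : nat} (p : 'I_N -> R).
Hypothesis p_gt0 : forall i, (0 < p i)%R.
Hypothesis p_sum : (\sum_(i < N) p i = 1)%R.

(** Endpoints of the partition of [0, 1). The index is a natural number so that [cumul i.+1] also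
    makes sense for the last [i]. *)
Definition cumul (k : nat) : R := (\sum_(j < N | (j < k)%N) p j)%R.

Lemma cumul0 : cumul 0 = 0%R. Proof. exact: big_pred0. Qed.

Lemma cumulN : cumul N = 1%R.
Proof. by rewrite -p_sum; apply: eq_bigl => j; rewrite ltn_ord. Qed.

Lemma cumulS (i : 'I_N) : cumul i.+1 = (cumul i + p i)%R.
Proof.
rewrite /cumul (bigD1 i)//= addrC; congr (_ + _)%R; apply: eq_bigl => j.
by rewrite ltnS ltn_neqAle andbC.
Qed.

Lemma cumul_le (k l : nat) : (k <= l)%N -> (cumul k <= cumul l)%R.
Proof.
move=> kl; rewrite /cumul big_mkcond [leRHS]big_mkcond; apply: ler_sum => j _.
case: ifPn => jk; first by rewrite (leq_trans jk).
by case: ifPn => // _; exact: ltW.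
Qed.

Lemma cumul_partition (k : nat) (A : set (measurableTypeR R)) : (k <= N)%N ->
  measurable A ->
  lebesgue_measure (A `&` `[0%R, cumul k[) =
  \sum_(i < N | (i < k)%N) lebesgue_measure (A `&` `[cumul i, cumul i.+1[).
Proof.
move=> + mA; elim: k => [_|k IH kN].
  by rewrite cumul0 set_itvco0 setI0 measure0 big_pred0.
pose i := Ordinal kN; rewrite (bigD1 i)//=.
rewrite (eq_bigl (fun j : 'I_N => (j < k)%N)); last first.
  by move=> j; rewrite ltnS ltn_neqAle andbC.
rewrite -IH 1?ltnW// addeC -measureU.
- rewrite -setIUr; congr (lebesgue_measure (A `&` _)).
  apply/seteqP; split=> x /=; rewrite !in_itv/=.
    move=> /andP[-> xk]; case: (ltP x (cumul k)) => xk'; first by left.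
    by right; rewrite xk.
  have c0 : (0 <= cumul k)%R by rewrite -cumul0 cumul_le.
  have cS : (cumul k <= cumul k.+1)%R by rewrite cumul_le.
  by move=> [|] /andP[x0 xk]; apply/andP; split; lra.
- by apply: measurableI => //; exact: measurable_itv.
- by apply: measurableI => //; exact: measurable_itv.
- rewrite -subset0 => x [[_ x1] [_ x2]].
  have : x \in `[0%R, cumul k[ := x1; have : x \in `[cumul k, cumul k.+1[ := x2.
  rewrite !in_itv/= => /andP[kx _] /andP[_ xk].
  by have := lt_le_trans xk kx; rewrite ltxx.
Qed.

Definition branch (i : 'I_N) : R -> R := affine (cumul i) (p i).

Lemma branch_itv i x :
  (branch i x \in `[cumul i, cumul i.+1[) = (x \in `[0%R, 1%R[).
Proof.
rewrite !in_itv/= cumulS /branch /affine lerDl ltrD2l pmulr_rge0//.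
by rewrite -[X in (_ < X)%R]mulr1 ltr_pM2l.
Qed.

(** [branch i] carries [0, 1) onto the [i]-th subinterval and scales lengths by [p i]; summing over
    the partition gives self-similarity. *)
Lemma unit_lebesgue_branch (A : set (measurableTypeR R)) : measurable A ->
  unit_lebesgue A =
  \sum_(i < N) (p i)%:E * unit_lebesgue (branch i @^-1` A).
Proof.
move=> mA; rewrite /unit_lebesgue /mrestr -[X in `[_, X[%classic]cumulN.
rewrite (cumul_partition (leqnn N) mA).
apply: eq_big => [i|i _]; first exact: ltn_ord.
rewrite cumulN (@lebesgue_measure_affine (cumul i) (p i))//; last first.
  by apply: measurableI => //; exact: measurable_itv.
congr (_ * lebesgue_measure _); rewrite preimage_setI; congr (_ `&` _).
by apply/seteqP; split => x /=; rewrite branch_itv.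
Qed.

(** The first digit of [x]; it is [None] exactly outside [0, 1). *)
Definition branch_index (x : R) : option 'I_N :=
  [pick i : 'I_N | x \in `[cumul i, cumul i.+1[].

Lemma branch_indexP (x : R) (i : 'I_N) :
  (branch_index x == Some i) = (x \in `[cumul i, cumul i.+1[).
Proof.
rewrite /branch_index; case: pickP => [j xj|xN]; last by rewrite xN.
apply/eqP/idP => [[<-//]|xi]; congr Some; apply/val_inj/eqP => /=.
move: xi xj; rewrite !in_itv/= => /andP[i1 i2] /andP[j1 j2].
rewrite eqn_leq; apply/andP; split; rewrite leqNgt; apply/negP => /cumul_le h.
- by have := lt_le_trans i2 (le_trans h j1); rewrite ltxx.
- by have := lt_le_trans j2 (le_trans h i1); rewrite ltxx.
Qed.

Definition unbranch (i : 'I_N) : R -> R :=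
  affine (- ((p i)^-1 * cumul i)) (p i)^-1.

Lemma branchK i : cancel (branch i) (unbranch i).
Proof.
move=> x; rewrite /unbranch /branch /affine mulrDr mulrA mulVf ?gt_eqF//.
by rewrite mul1r addrA addNr add0r.
Qed.

End unit_interval.

(** * Backward orbits *)

Section random_orbit.
Context {R : realType} {X : completeMetricType R} {N : nat}.
Variables (w : pifs R X N) (x0 : X).
Local Notation p := (pifs_weight w).
Local Notation Omega := (measurableTypeR R).
Local Notation P := (@unit_lebesgue R : probability Omega R).

Let p_gt0 := pifs_weight_gt0 w.

(* [orbit n] has the law of the [n]-step chain started at [x0], but it composes
   the maps backwards (the map applied last is read off first): this is what
   makes the sequence converge almost surely. *)
Fixpoint orbit (n : nat) (x : R) : X :=
  if n is m.+1 then
    if branch_index p x is Some i then w i (orbit m (unbranch p i x)) else x0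
  else x0.

Lemma orbit_branch n i x : x \in `[0, 1[ ->
  orbit n.+1 (branch p i x) = w i (orbit n x).
Proof.
rewrite -(branch_itv p_gt0 i) -branch_indexP//= => /eqP ->.
by rewrite branchK.
Qed.

(** The orbit is constant on each of finitely many Borel pieces, so [B] may be arbitrary. The
    induction splits by the first digit and passes from [B] to its preimages under the maps. *)
Lemma measurable_orbit_preimage n (B : set X) :
  measurable (orbit n @^-1` B : set Omega).
Proof.
elim: n B => [|n IH] B.
  have [Bx|nB] := pselect (B x0).
    by rewrite (_ : _ @^-1` _ = setT)//; apply/seteqP; split.
  by rewrite (_ : _ @^-1` _ = set0)//; apply/seteqP; split.
pose J i : set Omega := `[cumul p i, cumul p i.+1[%classic.
have mJ (i : 'I_N) : measurable (J i) by exact: measurable_itv.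
rewrite (_ : _ @^-1` _ = (\bigcup_(i : 'I_N)
    (J i `&` (unbranch p i @^-1` (orbit n @^-1` (w i @^-1` B))))) `|`
    (~` (\bigcup_(i : 'I_N) J i) `&` [set x | B x0])); last first.
  apply/seteqP; split => x /=.
    case E : (branch_index p x) => [i|] Bx.
      by left; exists i => //; split => //; rewrite /J /= -branch_indexP// E.
    by right; split => // -[i _]; rewrite /J /= -branch_indexP// E.
  move=> [[i _ []]|[nJ Bx]].
    by rewrite /J /= -branch_indexP// => /eqP ->.
  case E : (branch_index p x) => [i|//]; exfalso; apply: nJ; exists i => //.
  by rewrite /J /= -branch_indexP// E.
apply: (@measurableU _ Omega).
  apply: (@fin_bigcup_measurable _ Omega) => // i _.
  apply: (@measurableI _ Omega) => //.
  have := measurable_affine (- ((p i)^-1 * cumul p i)) (p i)^-1 measurableT (IH (w i @^-1` B)).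
  by rewrite setTI.
apply: (@measurableI _ Omega).
  by apply: measurableC; exact: (@fin_bigcup_measurable _ Omega).
have [Bx|nB] := pselect (B x0).
  by rewrite (_ : [set _ | _] = setT)//; apply/seteqP; split.
by rewrite (_ : [set _ | _] = set0)//; apply/seteqP; split.
Qed.

Lemma finite_range_orbit n : finite_set (range (orbit n)).
Proof.
elim: n => [|n IH].
  by apply: (@sub_finite_set _ _ [set x0]) => // _ [x _ <-].
apply: (@sub_finite_set _ _ ([set x0] `|` \bigcup_(i : 'I_N) (w i @` range (orbit n)))).
  move=> _ [x _ <-] /=; case: branch_index => [i|]; last by left.
  by right; exists i => //; exists (orbit n (unbranch p i x)) => //;
    exists (unbranch p i x).
rewrite finite_setU; split => //; apply: bigcup_finite => // i _.
exact: finite_image.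
Qed.

(** Finite ranges make every relation between two orbits measurable, with no product sigma-algebra
    and no separability of [X]. *)
Lemma measurable_orbit2 n m (B : X -> X -> Prop) :
  measurable ([set x | B (orbit n x) (orbit m x)] : set Omega).
Proof.
rewrite (_ : [set _ | _] = \bigcup_(a in range (orbit n))
    (orbit n @^-1` [set a] `&` orbit m @^-1` [set b | B a b])); last first.
  apply/seteqP; split => [x Bx|x [a _ [/= <-]]//].
  by exists (orbit n x).
apply: fin_bigcup_measurable; first exact: finite_range_orbit.
by move=> a _; apply: measurableI; exact: measurable_orbit_preimage.
Qed.

Lemma measurable_fun_orbit2 n m (F : X -> X -> R) :
  measurable_fun [set: Omega] (fun x => F (orbit n x) (orbit m x)).
Proof. by move=> _ Y mY; rewrite setTI; exact: (measurable_orbit2 _ _ (fun a b => Y (F a b))). Qed.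

Let branchE (A : set Omega) : measurable A ->
  P A = (\sum_(i < N) (p i)%:E * P (branch p i @^-1` A))%E.
Proof. by move=> mA; apply: unit_lebesgue_branch => //; exact: pifs_weight_sum. Qed.

Let p_ge0 i : 0 <= p i. Proof. exact: ltW. Qed.

Let mbranch i : measurable_fun [set: Omega] (branch p i : Omega -> Omega).
Proof. exact: measurable_affine. Qed.

Lemma ae_unit_itv : {ae P, forall x, x \in `[0, 1[}.
Proof.
exists (~` `[0, 1[%classic); split => //.
- by apply: measurableC; exact: measurable_itv.
- have : lebesgue_measure (~` `[0, 1[%classic `&` `[0, 1[%classic : set Omega) = 0%E.
    by rewrite setICl measure0.
  by [].
Qed.

(** Both orbits read the same first digit, so the same map [w i] is applied last to each, while the
    remaining digits are again distributed by Lebesgue measure. *)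
Lemma integral_orbit_shift n m (F : X -> X -> R) : (forall a b, 0 <= F a b) ->
  (\int[P]_x (F (orbit n.+1 x) (orbit m.+1 x))%:E =
   \sum_(i < N) (p i)%:E * \int[P]_x (F (w i (orbit n x)) (w i (orbit m x)))%:E)%E.
Proof.
move=> F0; have mF k l (G : X -> X -> R) :
    measurable_fun [set: Omega] (fun x => (G (orbit k x) (orbit l x))%:E).
  by apply/measurable_EFinP; exact: measurable_fun_orbit2.
rewrite (ge0_integral_mixture p_ge0 mbranch branchE (mF _ _ _)); last first.
  by move=> x; rewrite lee_fin.
apply: eq_bigr => i _; congr (_ * _)%E; apply: ge0_ae_eq_integral => //.
- by apply: (measurableT_comp (mF n.+1 m.+1 F)); exact: mbranch.
- exact: (mF n m (fun a b => F (w i a) (w i b))).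
- by move=> x _; rewrite lee_fin.
- by move=> x _; rewrite lee_fin.
- apply: (@filterS _ _ (ae_filter_ringOfSetsType P) _ _ _ ae_unit_itv).
  by move=> x x01 _; rewrite !orbit_branch.
Qed.

(** The mean distance of two orbits, extended real so that the estimates below require no prior
    integrability. *)
Definition gap n m : \bar R := (\int[P]_x (mdist (orbit n x) (orbit m x))%:E)%E.

Let mgap n m : measurable_fun [set: Omega]
  (fun x => (mdist (orbit n x) (orbit m x))%:E).
Proof. by apply/measurable_EFinP; exact: (measurable_fun_orbit2 n m (@mdist R X)). Qed.

Lemma gap_triangle n m k : (gap n k <= gap n m + gap m k)%E.
Proof.
rewrite /gap -ge0_integralD//; try by move=> x _; rewrite lee_fin mdist_ge0.
apply: ge0_le_integral => //; try by move=> x _; rewrite -?EFinD lee_fin ?addr_ge0 ?mdist_ge0.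
- exact: emeasurable_funD.
- by move=> x _; rewrite -EFinD lee_fin metric_triangle.
Qed.

Lemma gap_step (kap d : R) n m : 0 < kap < 1 -> 0 < d ->
  (forall x y, \sum_(i < N) p i * mdist (w i x) (w i y)
               <= kap * mdist x y + (1 - kap) * d) ->
  (gap n.+1 m.+1 <= kap%:E * gap n m + ((1 - kap) * d)%:E)%E.
Proof.
move=> /andP[k0 k1] d0 wk; have d1 : 0 <= (1 - kap) * d by rewrite mulr_ge0//; lra.
rewrite /gap integral_orbit_shift; last by move=> a b; exact: mdist_ge0.
have mw i : measurable_fun [set: Omega]
    (fun x => (mdist (w i (orbit n x)) (w i (orbit m x)))%:E).
  by apply/measurable_EFinP; exact: (measurable_fun_orbit2 n m (fun a b => mdist (w i a) (w i b))).
under eq_bigr => i _.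
  rewrite -ge0_integralZl//; last 2 first.
    by move=> x _; rewrite lee_fin mdist_ge0.
    by rewrite lee_fin.
  over.
rewrite -ge0_integral_sum//=; last 2 first.
  by move=> i; apply: measurable_funeM.
  by move=> i x _; rewrite -EFinM lee_fin mulr_ge0 ?mdist_ge0.
rewrite -[X in (_ + X)%E](_ : \int[P]_x (cst ((1 - kap) * d)%:E x) = _)%E; last first.
  by rewrite integral_cst//= probability_setT mule1.
rewrite -ge0_integralZl//; last 2 first.
  by move=> x _; rewrite lee_fin mdist_ge0.
  by rewrite lee_fin ltW.
have mk : measurable_fun [set: Omega]
    (fun x => kap%:E * (mdist (orbit n x) (orbit m x))%:E)%E.
  exact: measurable_funeM.
rewrite -ge0_integralD//; last first.
  by move=> x _; rewrite -EFinM lee_fin mulr_ge0 ?mdist_ge0// ltW.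
apply: ge0_le_integral => //.
- move=> x _; apply: sume_ge0 => i _.
  by rewrite -EFinM lee_fin mulr_ge0 ?mdist_ge0.
- by apply: emeasurable_sum => i; exact: measurable_funeM.
- exact: emeasurable_funD.
- move=> x _; under eq_bigr do rewrite -EFinM.
  by rewrite sumEFin -EFinM -EFinD lee_fin.
Qed.

Hypothesis hw : average_rakotch w.

Lemma gap01_fin : exists2 b : R, 0 <= b & gap 0 1 = b%:E.
Proof.
exists (\sum_(i < N) p i * mdist x0 (w i x0)).
  by apply: sumr_ge0 => i _; rewrite mulr_ge0 ?mdist_ge0.
(* [orbit 0] is constantly [x0], so the shift is applied to an integrand that ignores its first
   argument. *)
rewrite /gap (@integral_orbit_shift 0 0 (fun a b => mdist x0 b)); last first.
  by move=> a b; exact: mdist_ge0.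
rewrite -sumEFin; apply: eq_bigr => i _ /=.
by rewrite integral_cst//= probability_setT mule1 EFinM.
Qed.

Lemma gap_bounded : exists2 C : R, 0 <= C & forall k, (gap 0 k <= C%:E)%E.
Proof.
have [kap [k01 _ wk]] := average_rakotch_affine hw.
have [b b0 b01] := gap01_fin; set k := kap 1.
have /andP[k0 k1] := k01 1 ltr01.
have C0 : 0 <= b / (1 - k) + 1.
  by rewrite addr_ge0// divr_ge0//; rewrite /k; lra.
(* This constant is the fixed point of [C = b + k C + (1 - k)], the recursion at scale 1. *)
exists (b / (1 - k) + 1) => //; elim=> [|n IH].
  rewrite /gap; under eq_integral do rewrite mdistxx.
  by rewrite integral0 lee_fin.
apply: (le_trans (gap_triangle 0 1 n.+1)); rewrite b01.
have := gap_step 0 n (k01 1 ltr01) ltr01 (wk 1 ltr01).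
rewrite -/k mulr1 => h.
apply: (@le_trans _ _ (b%:E + (k%:E * (b / (1 - k) + 1)%:E + (1 - k)%:E))%E).
  rewrite leeD2l// (le_trans h)// leeD2r//; apply: lee_wpmul2l => //.
  by rewrite lee_fin ltW.
rewrite -EFinM -!EFinD lee_fin.
have bE : b = b / (1 - k) * (1 - k) by rewrite divfK// subr_eq0 gt_eqF.
rewrite {1}bE; lra.
Qed.

Lemma gap_cauchy (e : R) : 0 < e ->
  exists n0, forall n k, (n0 <= n)%N -> (gap n (n + k) <= e%:E)%E.
Proof.
move=> e0; have [kap [k01 _ wk]] := average_rakotch_affine hw.
have [C C0 Cgap] := gap_bounded; have e2 : 0 < e / 2 by rewrite divr_gt0.
set k := kap (e / 2); have /andP[k0 k1] := k01 _ e2.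
(* At scale [e/2] the error is reproduced exactly, since [k (e/2) + (1 - k)(e/2) = e/2]; only the
   initial bound [C] is contracted. *)
have H n j : (gap n (n + j) <= (k ^+ n * C + e / 2)%:E)%E.
  elim: n => [|n IH].
    by rewrite expr0 mul1r (le_trans (Cgap _))// lee_fin lerDl ltW.
  rewrite addSn; apply: (le_trans (gap_step n (n + j) (k01 _ e2) e2 (wk _ e2))).
  rewrite -/k; apply: (@le_trans _ _ (k%:E * (k ^+ n * C + e / 2)%:E + ((1 - k) * (e / 2))%:E)%E).
    by rewrite leeD2r//; apply: lee_wpmul2l => //; rewrite lee_fin ltW.
  by rewrite -EFinM -EFinD lee_fin exprS; lra.
have /cvgrPdist_lt/(_ (e / 2) e2) : geometric C k @ \oo --> 0.
  by apply: cvg_geometric; rewrite gtr0_norm.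
case=> n0 _ n0P; exists n0 => n j nn0; apply: (le_trans (H n j)).
have := n0P n nn0; rewrite /= /geometric/= sub0r normrN mulrC lee_fin.
by move=> /(le_lt_trans (ler_norm _)); lra.
Qed.

End random_orbit.

(** * Almost sure limits of finitely valued random variables *)

Section fast_cauchy.
Context {R : realType} {X : completeMetricType R}.
Variables (y : nat -> X) (m : nat).
Hypothesis ym : forall k, (m <= k)%N -> mdist (y k) (y k.+1) <= 2^-1 ^+ k.

(** The right-hand side is the geometric sum of the steps from [k] to [l]; keeping both terms lets
    the induction close. *)
Lemma fast_cauchy_dist k l : (m <= k)%N -> (k <= l)%N ->
  mdist (y k) (y l) <= 2 * 2^-1 ^+ k - 2 * 2^-1 ^+ l.
Proof.
move=> mk; elim: l => [|l IH].
  by rewrite leqn0 => /eqP ->; rewrite mdistxx subrr.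
rewrite leq_eqVlt => /predU1P[->|]; first by rewrite mdistxx subrr.
rewrite ltnS => kl; apply: (le_trans (metric_triangle _ (y l) _)).
have := IH kl; have := ym (leq_trans mk kl); rewrite exprS; lra.
Qed.

Lemma fast_cauchy_le k l : (m <= k)%N -> (k <= l)%N ->
  mdist (y k) (y l) <= 2 * 2^-1 ^+ k.
Proof.
move=> mk kl; apply: le_trans (fast_cauchy_dist mk kl) _.
by rewrite gerBl mulr_ge0// exprn_ge0.
Qed.

Lemma half_expr_lt (e : R) : 0 < e -> exists n, forall k, (n <= k)%N ->
  2 * 2^-1 ^+ k < e.
Proof.
move=> e0; have /cvgrPdist_lt/(_ e e0)[n _ nP] : geometric (2 : R) 2^-1 @ \oo --> 0.
  by apply: cvg_geometric; rewrite ger0_norm// invf_lt1// ltr1n.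
exists n => k /nP; rewrite /= sub0r normrN /geometric/= ger0_norm//.
Qed.

Lemma fast_cauchy_cvg : exists z : X, y @ \oo --> z.
Proof.
suff yc : cvg (y @ \oo) by exists (lim (y @ \oo)).
apply: (@cauchy_cvg X); apply: cauchy_exP => e e0.
have [n nP] := half_expr_lt e0; exists (y (maxn m n)).
exists (maxn m n) => // k /= nk; rewrite ballEmdist /=.
by apply: le_lt_trans (nP (maxn m n) _); rewrite ?leq_maxr// fast_cauchy_le// leq_maxl.
Qed.

Lemma fast_cauchy_lim z k : y @ \oo --> z -> (m <= k)%N ->
  mdist (y k) z <= 2 * 2^-1 ^+ k.
Proof.
move=> yz mk; apply/ler_addgt0Pr => e e0.
have /metricType_numDomainType.cvgrPdist_le/(_ e e0)[n _ nP] := yz.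
have := nP (maxn k n) (leq_maxr _ _); rewrite metric_sym => h.
apply: (le_trans (metric_triangle _ (y (maxn k n)) _)).
by rewrite lerD// fast_cauchy_le// leq_maxl.
Qed.

End fast_cauchy.

Section limit_random_variable.
Context d (T : measurableType d) (R : realType) (X : completeMetricType R).
Variables (P : probability T R) (Y : nat -> T -> X).
Hypothesis mY : forall k l (B : X -> X -> Prop),
  measurable [set t | B (Y k t) (Y l t)].
Hypothesis finY : forall k, finite_set (range (Y k)).
Hypothesis gapY : forall k,
  (\int[P]_t (mdist (Y k t) (Y k.+1 t))%:E <= (4^-1 ^+ k)%:E)%E.

Let half_gt0 k : 0 < 2^-1 ^+ k :> R.
Proof. by rewrite exprn_gt0. Qed.

Let bad k := [set t | 2^-1 ^+ k < mdist (Y k t) (Y k.+1 t)].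

Let mbad k : measurable (bad k).
Proof. exact: (mY k k.+1 (fun a b => 2^-1 ^+ k < mdist a b)). Qed.

(** Markov's inequality gives [4^-k / 2^-k = 2^-k], written in the form of the geometric series
    summed in [Pgood]. *)
Let Pbad k : (P (bad k) <= (2 / (2 ^ k.+1)%:R)%:E)%E.
Proof.
have -> : 2 / (2 ^ k.+1)%:R = (2^-1 ^+ k)^-1 * 4^-1 ^+ k :> R.
  have -> : 4^-1 = 2^-1 * 2^-1 :> R by rewrite -invfM -natrM.
  by rewrite exprMn mulKf ?gt_eqF// expnS natrM natrX invfM mulrA divff ?mul1r// exprVn.
rewrite EFinM lee_pdivlMl//; apply: le_trans (gapY k).
rewrite -[X in P X]setIT -integral_indic//.
rewrite -ge0_integralZl//; last by apply/measurable_EFinP; exact: measurable_indic.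
apply: ge0_le_integral => //.
- by apply: measurable_funeM; apply/measurable_EFinP; exact: measurable_indic.
- by apply/measurable_EFinP => _ Z mZ; rewrite setTI;
    exact: (mY k k.+1 (fun a b => Z (mdist a b))).
- move=> t _; rewrite -EFinM lee_fin indicE; case: (boolP (t \in bad k)) => [|_].
    by rewrite inE mulr1 => /ltW.
  by rewrite mulr0 mdist_ge0.
Qed.

Let good m := [set t | forall k, (m <= k)%N ->
  mdist (Y k t) (Y k.+1 t) <= 2^-1 ^+ k].

Let goodC m : ~` good m = \bigcup_(k in ~` `I_m) bad k.
Proof.
apply/seteqP; split => t.
  move=> /existsNP[k /not_implyP[mk /negP]]; rewrite -ltNge => h.
  by exists k => //=; apply/negP; rewrite -leqNgt.
move=> [k /= /negP]; rewrite -leqNgt => mk bk gt.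
by have := lt_le_trans bk (gt k mk); rewrite ltxx.
Qed.

Let mgood m : measurable (good m).
Proof.
rewrite -[good m]setCK goodC; apply: measurableC.
by apply: bigcup_measurable => k _; exact: mbad.
Qed.

(** The Borel-Cantelli argument: the tails of a convergent series of probabilities tend to 0. *)
Let Pgood (e : R) : 0 < e -> exists m, (P (~` good m) <= e%:E)%E.
Proof.
move=> e0; have sum_fin : (\sum_(k <oo) P (bad k) < +oo)%E.
  apply: (@le_lt_trans _ _ 2%:E); last exact: ltry.
  apply: le_trans (epsilon_trick0 xpredT (ler0n R 2)).
  by apply: lee_nneseries => // k _ _; exact: Pbad.
have := nneseries_tail_cvg sum_fin (fun _ _ => measure_ge0 P _).
move=> /fine_cvgP[[n0 _ fin] /cvgrPdist_lt /(_ e e0)[n1 _ nP]].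
pose n := maxn n0 n1; exists n; apply: le_trans.
  apply: (measure_sigma_subadditive_tail P (F := bad) (N := n)) => //.
    exact: measurableC.
  by rewrite goodC.
have := nP n (leq_maxr _ _); rewrite /= sub0r normrN => /ltW h.
rewrite -[leLHS]fineK; last exact: (fin n (leq_maxl _ _)).
by rewrite lee_fin (le_trans _ h)// ler_norm.
Qed.

Let conv := \bigcup_m good m.

Let mconv : measurable conv.
Proof. exact: bigcupT_measurable. Qed.

Let Pconv : P (~` conv) = 0%E.
Proof.
apply/eqP; rewrite eq_le measure_ge0 andbT; apply/lee_addgt0Pr => e e0.
have [m mP] := Pgood e0; rewrite add0e; apply: le_trans mP.
apply: le_measure; rewrite ?inE; [exact: measurableC|exact: measurableC|].
by apply: subsetC => t gt; exists m.
Qed.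

Lemma limit_random_variable : exists Z : T -> X,
  [/\ measurable_fun setT (Z : T -> borel X),
      {ae P, forall t, Y k t @[k --> \oo] --> Z t} &
      forall e : R, 0 < e -> exists2 K : set X, compact K &
        (P (Z @^-1` (~` K)) <= e%:E)%E].
Proof.
(* Off the convergence set [Z] takes the constant value [point], which keeps it measurable. *)
have /choice[Z ZP] t : exists z : X, (conv t -> Y k t @[k --> \oo] --> z) /\
    (~ conv t -> z = point).
  have [[m _ gt]|nc] := pselect (conv t); last by exists point.
  by have [z zP] := fast_cauchy_cvg gt; exists z; split => // -[]; exists m.
have Zlim t : conv t -> Y k t @[k --> \oo] --> Z t by have [] := ZP t.
have Zpoint t : ~ conv t -> Z t = point by have [] := ZP t.
have mZ : measurable_fun setT (Z : T -> borel X).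
  apply: (measurability (@open X : set (set (borel X)))) => // _ [U oU <-].
  rewrite setTI.
  (* Where the sequence converges, the limit lies in [U] exactly when, for some [n], the balls of
     radius [1/(n+1)] about the terms eventually lie in [U]. *)
  pose E := \bigcup_n \bigcup_k \bigcap_(l in [set l | (k <= l)%N])
    [set t | forall y, mdist (Y l t) y < n.+1%:R^-1 -> U y].
  rewrite (_ : _ @^-1` _ = (conv `&` E) `|` (~` conv `&` [set t | U point])).
    apply: measurableU; apply: measurableI => //; last 2 first.
    + exact: measurableC.
    + have [Up|nU] := pselect (U point).
        by rewrite (_ : [set _ | _] = setT)//; apply/seteqP; split.
      by rewrite (_ : [set _ | _] = set0)//; apply/seteqP; split.
    apply: bigcupT_measurable => n; apply: bigcupT_measurable => k.
    apply: bigcap_measurableType => l _.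
    exact: (mY l l (fun a _ => forall y, mdist a y < n.+1%:R^-1 -> U y)).
  apply/seteqP; split => t.
    move=> Ut; have [ct|nct] := pselect (conv t); last first.
      by right; split => //=; rewrite -(Zpoint t nct).
    left; split => //; have [e e0 eU] := (open_mdistP U).1 oU _ Ut.
    have e2 : 0 < e / 2 by rewrite divr_gt0.
    have [n ne] : exists n, (n.+1%:R^-1 : R) < e / 2.
      near \oo => n; exists n; near: n.
      exact: (near_infty_natSinv_lt (PosNum e2)).
    have [k _ kP] := (@metricType_numDomainType.cvgrPdist_lt _ _ _ _ _ _ _).1 (Zlim t ct) _ e2.
    exists n => //; exists k => // l kl y ly; apply: eU.
    have h1 : mdist (Z t) (Y l t) < e / 2 := kP l kl.
    apply: (le_lt_trans (metric_triangle _ (Y l t) _)).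
    by rewrite [ltRHS]splitr ltrD// (lt_trans ly).
  move=> [[ct [n _ [k _ tU]]]|[nct /=]]; last by rewrite -(Zpoint t nct).
  have n0 : 0 < n.+1%:R^-1 :> R by rewrite invr_gt0.
  have [l _ lP] := (@metricType_numDomainType.cvgrPdist_lt _ _ _ _ _ _ _).1 (Zlim t ct) _ n0.
  apply: (tU (maxn k l)); first exact: leq_maxl.
  by rewrite metric_sym; apply: lP; exact: leq_maxr.
exists Z; split => //.
- exists (~` conv); split => //; first exact: measurableC.
  by apply: subsetC => t ct; exact: Zlim.
- move=> e e0; have [m mP] := Pgood e0.
  (* Each level is a finite union of closed balls of radius [2 * 2^-k], so [K] is closed and totally
     bounded; on [good m] the limit stays in it. *)
  pose K := \bigcap_(k in [set k | (m <= k)%N])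
    \bigcup_(a in range (Y k)) [set x : X | mdist a x <= 2 * 2^-1 ^+ k].
  have cK : closed K.
    apply: closed_bigI => k _; apply: closed_bigcup => [|a _]; first exact: finY.
    rewrite (_ : [set _ | _] = (fun x : X => mdist x a) @^-1` [set r | r <= 2 * 2^-1 ^+ k]).
      apply: preimage_closed; last exact: closed_le.
      by move=> x _; exact: (lip1_continuous (lip1_mdist a)).
    by apply/seteqP; split => x /=; rewrite metric_sym.
  exists K.
    apply: totally_bounded_compact => //.
    move=> r r0; have [n nP] := half_expr_lt r0.
    exists (range (Y (maxn m n))); first exact: finY.
    move=> x /(_ (maxn m n) (leq_maxl _ _))[a Ya ax].
    by exists a => //; apply: le_lt_trans ax (nP _ (leq_maxr _ _)).
  apply: le_trans mP; apply: le_measure; rewrite ?inE.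
  - rewrite -[X in measurable X]setTI; apply: mZ => //; apply: measurableC.
    exact: closed_borel_measurable.
  - exact: measurableC.
  - apply: subsetC => t gt k mk; exists (Y k t); first by exists t.
    by apply: (@fast_cauchy_lim _ _ (Y ^~ t) m gt (Z t) k _ mk); apply: Zlim; exists m.
Unshelve. all: by end_near. Qed.

End limit_random_variable.

(** * The invariant measure *)

Section limit_law.
Context {R : realType} {X : completeMetricType R} {N : nat}.
Variable w : pifs R X N.
Hypothesis hw : average_rakotch w.
Local Notation p := (pifs_weight w).
Local Notation Omega := (measurableTypeR R).
Local Notation P := (@unit_lebesgue R : probability Omega R).

Let x0 : X := point.
Let p_ge0 i : 0 <= p i. Proof. by rewrite ltW// pifs_weight_gt0. Qed.
Let mbranch i : measurable_fun [set: Omega] (branch p i : Omega -> Omega).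
Proof. exact: measurable_affine. Qed.
Let branchE (A : set Omega) : measurable A ->
  P A = (\sum_(i < N) (p i)%:E * P (branch p i @^-1` A))%E.
Proof.
by move=> mA; apply: unit_lebesgue_branch => //;
  [exact: pifs_weight_gt0|exact: pifs_weight_sum].
Qed.

Let morbit n (h : X -> R) : measurable_fun [set: Omega] (h \o orbit w x0 n).
Proof. exact: (measurable_fun_orbit2 w x0 n n (fun a _ => h a)). Qed.

(** The counterpart of [Rintegral_markov_operator] for orbit laws, again obtained by splitting off
    the first digit. *)
Lemma Rintegral_orbit_transfer n (B : R) (h : X -> R) :
  (forall x, `|h x| <= B) ->
  \int[P]_t h (orbit w x0 n.+1 t) = \int[P]_t transfer w h (orbit w x0 n t).
Proof.
move=> hB; have hi i : P.-integrable [set: Omega]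
    (EFin \o (fun t => h (w i (orbit w x0 n t)))).
  apply: (@bounded_integrable _ Omega _ _ _ B) => //.
  exact: (morbit n (h \o w i)).
rewrite Rintegral_sum; last first.
  by move=> i; exact: (integrableZl measurableT (p i) (hi i)).
rewrite (Rintegral_mixture p_ge0 mbranch branchE (morbit n.+1 h)); last first.
  move=> i; apply: (@bounded_integrable _ Omega _ _ _ B) => //.
    exact: (measurableT_comp (morbit n.+1 h) (mbranch i)).
  by move=> t; exact: hB.
apply: eq_bigr => i _; rewrite RintegralZl//; congr (_ * fine _).
apply: ae_eq_integral => //.
- by apply/measurable_EFinP; exact: (measurableT_comp (morbit n.+1 h) (mbranch i)).
- by apply/measurable_EFinP; exact: (morbit n (h \o w i)).
- apply: (@filterS _ _ (ae_filter_ringOfSetsType P) _ _ _ ae_unit_itv).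
  by move=> t t01 _; rewrite /comp orbit_branch.
Qed.

Lemma Rintegral_orbit_dist n m (k B e : R) (h : X -> R) : 0 < k ->
  lipschitz_fun k h -> (forall x, `|h x| <= B) -> (gap w x0 n m <= e%:E)%E ->
  `|\int[P]_t h (orbit w x0 n t) - \int[P]_t h (orbit w x0 m t)| <= k * e.
Proof.
move=> k0 hk hB ge.
have Ih j : P.-integrable [set: Omega] (EFin \o (h \o orbit w x0 j)).
  by apply: (@bounded_integrable _ Omega _ _ _ B); [exact: morbit|move=> t; exact: hB].
rewrite -RintegralB//; [|exact: Ih|exact: Ih].
have Id : P.-integrable [set: Omega]
    (EFin \o (fun t => h (orbit w x0 n t) - h (orbit w x0 m t))).
  exact: (integrableB measurableT (Ih n) (Ih m)).
apply: (le_trans (le_normr_Rintegral measurableT Id)).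
have In := integrable_norm Id.
rewrite -lee_fin fineK; last exact: (integrable_fin_num measurableT In).
have md : measurable_fun [set: Omega] (fun t => (mdist (orbit w x0 n t) (orbit w x0 m t))%:E).
  by apply/measurable_EFinP; exact: (measurable_fun_orbit2 w x0 n m (@mdist R X)).
apply: (@le_trans _ _ (k%:E * gap w x0 n m)%E); last first.
  by rewrite EFinM; apply: lee_wpmul2l => //; rewrite lee_fin ltW.
rewrite /gap -ge0_integralZl//; last 2 first.
  by move=> t _; rewrite lee_fin mdist_ge0.
  by rewrite lee_fin ltW.
apply: ge0_le_integral => //.
- exact: (measurable_int _ In).
- exact: measurable_funeM.
- by move=> t _; rewrite -EFinM lee_fin.
Qed.

(** The first bound yields almost sure convergence along [nn]; the second, between consecutive
    times, yields invariance of the limit law. *)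
Lemma fast_subsequence : exists nn : nat -> nat,
  forall k, (gap w x0 (nn k) (nn k.+1) <= (4^-1 ^+ k)%:E)%E /\
    (gap w x0 (nn k) (nn k).+1 <= (4^-1 ^+ k)%:E)%E.
Proof.
have /choice[f fP] k : exists n0, forall n j, (n0 <= n)%N ->
    (gap w x0 n (n + j) <= (4^-1 ^+ k)%:E)%E.
  by apply: gap_cauchy hw _ _; rewrite exprn_gt0.
(* Partial sums dominate [f k] and make [nn k.+1] equal to [nn k + f k.+1], the shape that the
   Cauchy bound needs. *)
exists (fun k => \sum_(j < k.+1) f j)%N => k.
have fk : (f k <= \sum_(j < k.+1) f j)%N by rewrite big_ord_recr leq_addl.
have fkS := fP k _ (f k.+1) fk; have fk1 := fP k _ 1%N fk.
split; last by move: fk1; rewrite addn1.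
by rewrite [X in gap _ _ _ X]big_ord_recr.
Qed.

Lemma exists_invariant_measure : exists mu : probability (borel X) R,
  P1 mu /\ markov_operator w mu ≡μ mu.
Proof.
have [nn nnP] := fast_subsequence.
have [Z [mZ Zlim tight]] := @limit_random_variable _ Omega R X P
  (fun k => orbit w x0 (nn k))
  (fun k l => measurable_orbit2 w x0 (nn k) (nn l))
  (fun k => finite_range_orbit w x0 (nn k)) (fun k => (nnP k).1).
pose Zm : {mfun Omega >-> borel X} := HB.pack Z (isMeasurableFun.Build _ _ _ _ _ mZ).
pose mu : probability (borel X) R := distribution P Zm.
have Pmu : P1 mu.
  split; first by apply: tight_radon => e /tight[K cK Ke]; exists K.
  exists x0; have [C C0 Cgap] := gap_bounded x0 hw.
  apply: (@le_lt_trans _ _ C%:E); last exact: ltry.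
  have md : measurable_fun [set: borel X] (fun x : X => mdist x x0).
    exact: continuous_real_measurable (lip1_continuous (lip1_mdist x0)).
  rewrite (ge0_integral_pushforward mZ P measurableT); last 2 first.
    exact/measurable_EFinP.
    by move=> x _; rewrite lee_fin mdist_ge0.
  rewrite preimage_setT.
  pose F k t := (mdist (orbit w x0 (nn k) t) x0)%:E.
  have mF k : measurable_fun [set: Omega] (F k).
    by apply/measurable_EFinP; exact: (morbit (nn k) (fun a => mdist a x0)).
  have F0 k t : setT t -> (0 <= F k t)%E by move=> _; rewrite lee_fin mdist_ge0.
  (* Fatou's lemma transfers the uniform bound on the mean distances to [x0] to the limit. *)
  apply: (@le_trans _ _ (\int[P]_t limn_einf (F ^~ t))%E).
    apply: ae_ge0_le_integral => //.
    - by move=> t _; rewrite lee_fin mdist_ge0.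
    - by apply/measurable_EFinP; exact: (measurableT_comp md mZ).
    - move=> t _; rewrite limn_einf_lim; apply: lime_ge; first exact: is_cvg_einfs.
      apply: nearW => k; apply: le_ereal_inf_tmp => _ [l _ <-]; exact: F0.
    - rewrite /limn_einf; apply: measurableT_comp => //.
      by apply: measurable_fun_limn_esup => k; exact: measurableT_comp (mF k).
    - apply: (@filterS _ _ (ae_filter_ringOfSetsType P) _ _ _ Zlim) => t tZ _.
      have : F k t @[k --> \oo] --> (mdist (Z t) x0)%:E.
        apply: cvg_EFin; first exact: nearW.
        have c : mdist (orbit w x0 (nn k) t) x0 @[k --> \oo] --> mdist (Z t) x0.
          exact: (@cvg_comp _ _ _ _ _ _ (nbhs (Z t)) _ tZ (lip1_continuous (lip1_mdist x0) (x := Z t))).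
        exact: c.
      by move=> /cvg_limn_einf_sup[-> _].
  apply: le_trans (fatou P measurableT mF F0) _.
  rewrite limn_einf_lim; apply: lime_le; first exact: is_cvg_einfs.
  apply: nearW => k; apply: (@le_trans _ _ (\int[P]_t F k t)%E).
    by apply: ereal_inf_lbound; exists k => /=.
  apply: le_trans (Cgap (nn k)); rewrite /gap le_eqVlt; apply/orP; left; apply/eqP.
  by apply: eq_integral => t _; rewrite /F metric_sym.
exists mu; split => //; apply: eq_lipschitz_measure => k B h k0 hk hB.
rewrite (Rintegral_markov_operator hw Pmu k0 hk).
have [c c0 tc] := transfer_lipschitz hw.
have lim g (j : R) : 0 < j -> lipschitz_fun j g -> (forall x, `|g x| <= B) ->
    \int[P]_t g (orbit w x0 (nn k) t) @[k --> \oo] --> \int[mu]_x g x.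
  move=> j0 gj gB; have mg := lipschitz_fun_measurable j0 gj.
  have -> : \int[mu]_x g x = \int[P]_t g (Z t).
    congr fine; rewrite (integral_pushforward mZ)//.
      exact/measurable_EFinP.
    apply: (@bounded_integrable _ Omega _ _ _ B) => //.
    exact: (measurableT_comp mg mZ).
  apply: (@bounded_cvg_Rintegral _ Omega _ P _ _ B) => //.
  - by move=> k'; exact: morbit.
  - exact: (measurableT_comp mg mZ).
  - apply: (@filterS _ _ (ae_filter_ringOfSetsType P) _ _ _ Zlim) => t tZ.
    exact: (cvg_comp _ _ tZ (lipschitz_fun_continuous j0 gj (x := Z t))).
have l1 := lim _ _ k0 hk hB.
have l2 := lim _ _ (mulr_gt0 k0 c0) (tc _ _ k0 hk) (transfer_bounded w hB).
(* Integrating [transfer w h] along the orbit amounts to one more step, and consecutive steps become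
   close in mean. *)
have d0 : (\int[P]_t h (orbit w x0 (nn k) t) -
    \int[P]_t transfer w h (orbit w x0 (nn k) t)) @[k --> \oo] --> (0 : R).
  apply/cvgrPdist_le => e e0; have e1 : 0 < e / k by rewrite divr_gt0.
  have g4 : `|4^-1 : R| < 1 by rewrite ger0_norm// invf_lt1// ltr1n.
  have /cvgrPdist_le/(_ _ e1) := cvg_expr g4.
  apply: filterS => n; rewrite sub0r normrN => n1.
  rewrite sub0r normrN -(Rintegral_orbit_transfer _ hB).
  apply: (le_trans (Rintegral_orbit_dist k0 hk hB (nnP n).2)).
  by rewrite -ler_pdivlMl// mulrC (le_trans _ n1)// ler_norm.
have e := cvg_unique (@Rhausdorff R) (cvgB l1 l2) d0.
by rewrite (subr0_eq (e _ _)).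
Qed.

End limit_law.

(** * Uniqueness of the invariant measure and convergence of the iterates *)

Section convergence.
Context {R : realType} {X : completeMetricType R} {N : nat}.
Variable w : pifs R X N.
Hypothesis hw : average_rakotch w.
Implicit Types mu nu : probability (borel X) R.

(** Invariance is equality on measurable sets rather than of the packed structures, so [dMK] must be
    shown to respect it. *)
Lemma eq_measure_dMK mu mu' nu nu' : mu ≡μ mu' -> nu ≡μ nu' ->
  dMK mu nu = dMK mu' nu'.
Proof.
move=> e e'; rewrite /dMK; congr sup; apply: eq_imagel => f _.
by congr (fine _ - fine _); apply: eq_measure_integral => A mA _;
  [exact: e|exact: e'].
Qed.

Lemma dMK_Rintegral_dist mu nu (k : R) h : P1 mu -> P1 nu -> 0 < k ->
  lipschitz_fun k h -> `|\int[mu]_x h x - \int[nu]_x h x| <= k * dMK mu nu.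
Proof.
move=> Pmu Pnu k0 hk; rewrite ler_norml (lipschitz_dMK Pmu Pnu k0 hk) andbT.
have Nhk : lipschitz_fun k (fun x => - h x).
  by move=> x y; rewrite -opprD normrN; exact: hk.
have := lipschitz_dMK Pmu Pnu k0 Nhk.
rewrite !RintegralN; [lra|exact: lipschitz_integrable Pnu k0 hk|
  exact: lipschitz_integrable Pmu k0 hk].
Qed.

Lemma iter_markov_operator_P1 mu n : P1 mu -> P1 (iter n (markov_operator w) mu).
Proof. by move=> Pmu; elim: n => //= n; exact: markov_operator_P1. Qed.

Lemma dMK_invariant_cvg mu nu : P1 mu -> P1 nu -> markov_operator w nu ≡μ nu ->
  dMK (iter n (markov_operator w) mu) nu @[n --> \oo] --> (0 : R).
Proof.
move=> Pmu Pnu inv; have [kap [k01 _ wk]] := average_rakotch_affine hw.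
pose r n := dMK (iter n (markov_operator w) mu) nu.
have r0 n : 0 <= r n by apply: dMK_ge0 => //; exact: iter_markov_operator_P1.
apply/cvgrPdist_le => e e0; have e2 : 0 < e / 2 by rewrite divr_gt0.
have /andP[k0 k1] := k01 _ e2; set k := kap (e / 2) in k0 k1.
have H n : r n <= k ^+ n * r 0%N + e / 2.
  elim: n => [|n IH]; first by rewrite expr0 mul1r lerDl ltW.
  have : r n.+1 <= k * r n + (1 - k) * (e / 2).
    (* Invariance turns [nu] into its own image, so that both arguments are images under the
       operator. *)
    rewrite /r -(eq_measure_dMK (fun _ _ => erefl) inv) iterS.
    by apply: markov_operator_dMK => //; [exact: k01|exact: wk|exact: iter_markov_operator_P1].
  have : k * r n <= k * (k ^+ n * r 0%N + e / 2) by rewrite ler_wpM2l// ltW.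
  rewrite exprS; lra.
have g1 : `|k| < 1 by rewrite gtr0_norm.
have /cvgrPdist_le/(_ _ e2) := cvg_geometric (r 0%N) g1.
apply: filterS => n; rewrite /= /geometric/= !sub0r !normrN => h.
rewrite ger0_norm; last exact: r0.
apply: (le_trans (H n)).
by have := le_trans (ler_norm _) h; lra.
Qed.

Lemma markov_iterates_weak_cvg mu nu : P1 mu -> P1 nu ->
  markov_operator w nu ≡μ nu ->
  weak_cvg (fun n => iter n (markov_operator w) mu) nu.
Proof.
move=> Pmu Pnu inv; apply: lipschitz_weak_cvg => k B h k0 hk _.
apply/(@cvgrPdist_le _ R^o) => e e0; have ek : 0 < e / k by rewrite divr_gt0.
have /cvgrPdist_le/(_ _ ek) := dMK_invariant_cvg Pmu Pnu inv.
apply: filterS => n; rewrite sub0r normrN => h1.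
rewrite distrC; apply: le_trans.
  by apply: dMK_Rintegral_dist k0 hk => //; exact: iter_markov_operator_P1.
by rewrite -ler_pdivlMl// mulrC (le_trans _ h1)// ler_norm.
Qed.

(** At every scale [e] the distance [D] satisfies [D <= kap D + (1 - kap) e], hence [D <= e]. So
    [D = 0], and Lipschitz functions cannot separate the two measures. *)
Lemma invariant_measure_unique mu nu : P1 mu -> P1 nu ->
  markov_operator w mu ≡μ mu -> markov_operator w nu ≡μ nu -> mu ≡μ nu.
Proof.
move=> Pmu Pnu imu inu; apply: eq_lipschitz_measure => k B h k0 hk hB.
have D0 : dMK mu nu = 0.
  apply/eqP; rewrite eq_le dMK_ge0// andbT; apply/ler_addgt0Pr => e e0.
  rewrite add0r; have [kap [k01 _ wk]] := average_rakotch_affine hw.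
  have := markov_operator_dMK hw (k01 _ e0) e0 (wk _ e0) Pmu Pnu.
  rewrite (eq_measure_dMK imu inu) => De.
  have /andP[_ k1] := k01 _ e0.
  have : (1 - kap e) * dMK mu nu <= (1 - kap e) * e by lra.
  by rewrite ler_pM2l// subr_gt0.
have := dMK_Rintegral_dist Pmu Pnu k0 hk.
by rewrite D0 mulr0 normr_le0 subr_eq0 => /eqP.
Qed.

End convergence.

Theorem theorem6p10 (R : realType) (X : completeMetricType R) (N : nat)
    (w : pifs R X N) (hw : average_rakotch w) :
  rakotch_contraction (@P1 R X) (@dMK R X) (markov_operator w) /\
  exists mu_star : probability (borel X) R,
    [/\ P1 mu_star,
        markov_operator w mu_star ≡μ mu_star,
        forall nu : probability (borel X) R,
          P1 nu -> markov_operator w nu ≡μ nu -> nu ≡μ mu_star &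
        forall mu : probability (borel X) R,
          P1 mu -> weak_cvg (fun n => iter n (markov_operator w) mu) mu_star].
Proof.
split; first exact: markov_operator_rakotch.
have [mu_star [Pmu inv]] := exists_invariant_measure hw.
exists mu_star; split => // [nu Pnu nuE|mu Pmu'].
- exact: (invariant_measure_unique hw).
- exact: (markov_iterates_weak_cvg hw).
Qed.
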